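(* Let $\mathcal U\subseteq M(\mathbb C)^g$ and $\mathcal V\subseteq M(\mathbb C)^{\tilde g}$ be bounded non-commutative domains, both containing $0$, and let $f:\mathcal U\to\mathcal V$ be a proper analytic free map with $f(0)=0$. If $\mathcal U$ and the range $f(\mathcal U)=(f[n](\mathcal U(n)))_n$ are circular, then $f$ is linear, i.e. for each $n$, $f[n]$ is the restriction to $\mathcal U(n)$ of a $\mathbb C$-linear map $M_n(\mathbb C)^g\to M_n(\mathbb C)^{\tilde g}$.
   Context: $M_n(\mathbb C)^g$ denotes $g$-tuples $X=(X_1,\dots,X_g)$ of $n\times n$ complex matrices; products, unitary conjugation and direct sums of tuples are entrywise. A non-commutative set $\mathcal U\subseteq M(\mathbb C)^g$ is a sequence $(\mathcal U(n))_n$, $\mathcal U(n)\subseteq M_n(\mathbb C)^g$, closed under simultaneous unitary similarity and under direct sums; a non-commutative domain if each $\mathcal U(n)$ is open and connected; containing $0$ if $0\in\mathcal U(n)$ for all $n$; bounded if there is $C\in\mathbb R$ with $C^2I-\sum_jX_jX_j^*\succ0$ for all $n$ and $X\in\mathcal U(n)$; circular if $e^{it}X\in\mathcal U(n)$ for all $n$, $X\in\mathcal U(n)$, $t\in\mathbb R$. A free map $f:\mathcal U\to\mathcal V$ is a sequence of functions $f[n]:\mathcal U(n)\to\mathcal V(n)$ such that whenever $X\in\mathcal U(n)$, $Y\in\mathcal U(m)$, $\Gamma\in\mathbb C^{n\times m}$ with $X\Gamma=\Gamma Y$, then $f[n](X)\Gamma=\Gamma f[m](Y)$; it is analytic if each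 $f[n]$ is holomorphic, and proper if each $f[n]:\mathcal U(n)\to\mathcal V(n)$ is proper. $f(0)=0$ means $f[n](0)=0$ for all $n$. *)

(* Defs.v *)
(* MathComp-Analysis over R : realType, complex numbers R[i]
   from mathcomp-real-closed (complex.v). *)
From HB Require Import structures.
From mathcomp Require Import all_boot all_order all_algebra.
From mathcomp Require Import all_classical all_reals all_analysis.
From mathcomp Require Export complex.
Set Implicit Arguments.
Unset Strict Implicit.
Unset Printing Implicit Defensive.
Import Order.TTheory GRing.Theory Num.Theory.
Import numFieldNormedType.Exports.
Local Open Scope ring_scope.
Local Open Scope complex_scope.
Local Open Scope classical_set_scope.

(* A g-tuple X = (X_1,...,X_g) of n x n complex matrices is encoded as the
   n x (g*n) block-row matrix [X_1 X_2 ... X_g]; this is a finite-dimensional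
   normed C-vector space (M_n(C)^g with the max-entry norm). *)
(* the normed C-vector space structure (C = R[i], max-entry norm) *)
Notation tupN R g n := ('M[R[i]]_(n, g * n) : normedModType R[i]).

(* j-th component X_j of the tuple X *)
Definition tcomp (R : realType) (g n : nat) (X : 'M[R[i]]_(n, g * n)) (j : 'I_g)
  : 'M[R[i]]_n := \matrix_(a, b) X a (mxvec_index j b).

(* the tuple with components F j *)
Definition tmk (R : realType) (g n : nat) (F : 'I_g -> 'M[R[i]]_n)
  : 'M[R[i]]_(n, g * n) :=
  \matrix_(a, k) (mxvec (\matrix_(j < g, b < n) F j a b)) 0 k.

(* conjugate transpose *)
Definition adjmx (R : realType) (m n : nat) (A : 'M[R[i]]_(m, n)) : 'M[R[i]]_(n, m) :=
  (map_mx (fun z : R[i] => z^*) A)^T.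

Definition unitarymx (R : realType) (n : nat) (U : 'M[R[i]]_n) : Prop :=
  U *m adjmx U = 1%:M /\ adjmx U *m U = 1%:M.

(* A is (Hermitian) positive definite: A ≻ 0 *)
Definition posdefmx (R : realType) (n : nat) (A : 'M[R[i]]_n) : Prop :=
  A = adjmx A /\ forall v : 'cV[R[i]]_n, v != 0 -> 0 < (adjmx v *m A *m v) 0 0.

(* a non-commutative set: a sequence of sets U n ⊆ M_n(C)^g *)
Definition ncset (R : realType) (g : nat) := forall n : nat, set 'M[R[i]]_(n, g * n).

Definition nc_closed (R : realType) (g : nat) (U : ncset R g) : Prop :=
  (forall (n : nat) (X : 'M[R[i]]_(n, g * n)) (W : 'M[R[i]]_n),
      U n X -> unitarymx W -> U n (tmk (fun j => adjmx W *m tcomp X j *m W)))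
  /\ (forall (n m : nat) (X : 'M[R[i]]_(n, g * n)) (Y : 'M[R[i]]_(m, g * m)),
      U n X -> U m Y ->
      U (n + m)%N (tmk (fun j => block_mx (tcomp X j) 0 0 (tcomp Y j)))).

Definition nc_domain (R : realType) (g : nat) (U : ncset R g) : Prop :=
  nc_closed U /\ forall n : nat, @open (tupN R g n) (U n) /\ @connected (tupN R g n) (U n).

Definition nc_contains0 (R : realType) (g : nat) (U : ncset R g) : Prop :=
  forall n : nat, U n 0.

Definition nc_bounded (R : realType) (g : nat) (U : ncset R g) : Prop :=
  exists c : R, forall (n : nat) (X : 'M[R[i]]_(n, g * n)), U n X ->
    posdefmx (((c%:C) ^+ 2)%:M - \sum_(j < g) tcomp X j *m adjmx (tcomp X j)).

(* e^{it} X ∈ U(n) *)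
Definition nc_circular (R : realType) (g : nat) (U : ncset R g) : Prop :=
  forall (n : nat) (X : 'M[R[i]]_(n, g * n)) (t : R),
    U n X -> U n ((cos t +i* sin t) *: X).

(* a map between nc sets: a sequence of functions f n *)
Definition ncfun (R : realType) (g gt : nat) :=
  forall n : nat, 'M[R[i]]_(n, g * n) -> 'M[R[i]]_(n, gt * n).

Definition maps_into (R : realType) (g gt : nat) (U : ncset R g) (V : ncset R gt)
  (f : ncfun R g gt) : Prop :=
  forall (n : nat) (X : 'M[R[i]]_(n, g * n)), U n X -> V n (f n X).

Definition free_map (R : realType) (g gt : nat) (U : ncset R g) (f : ncfun R g gt)
  : Prop :=
  forall (n m : nat) (X : 'M[R[i]]_(n, g * n)) (Y : 'M[R[i]]_(m, g * m))
    (G : 'M[R[i]]_(n, m)),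
    U n X -> U m Y -> (forall j : 'I_g, tcomp X j *m G = G *m tcomp Y j) ->
    forall j : 'I_gt, tcomp (f n X) j *m G = G *m tcomp (f m Y) j.

(* holomorphic: complex-Frechet differentiable at every point of U(n) *)
Definition nc_analytic (R : realType) (g gt : nat) (U : ncset R g) (f : ncfun R g gt)
  : Prop :=
  forall (n : nat) (X : 'M[R[i]]_(n, g * n)), U n X ->
    differentiable (f n : tupN R g n -> tupN R gt n) (X : tupN R g n).

(* f n : U(n) -> V(n) is proper: preimages of compact subsets are compact *)
Definition nc_proper (R : realType) (g gt : nat) (U : ncset R g) (V : ncset R gt)
  (f : ncfun R g gt) : Prop :=
  forall (n : nat) (K : set 'M[R[i]]_(n, gt * n)),
    K `<=` V n -> @compact (tupN R gt n) K ->
    @compact (tupN R g n) (U n `&` (f n @^-1` K)).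

Definition nc_range (R : realType) (g gt : nat) (U : ncset R g) (f : ncfun R g gt)
  : ncset R gt := fun n => f n @` U n.

(* Main.v *)
(** Strong injectivity: if [B] intertwines [f X] and [f Y], then
    [Z t = [[X, t (B Y - X B)], [0, Y]]] is similar to [X (+) Y] and [f (Z t)]
    does not depend on [t]; by properness the whole line lies in the bounded set
    [U], so [B] intertwines [X] and [Y].  Hence for [|c| = 1] the formula
    [G X = f^-1 (c^-1 f (c X))] defines a free self-map [G] of [U], which fixes the
    shifts [[[0, K], [0, 0]]].  Free maps with bounded values are Lipschitz near [0]
    uniformly in the map, so all iterates of [G] nearly preserve differences of
    small tuples; since they stay bounded, [G] is the identity near [0], that is,
    [f (c X) = c f X].  Then the corner of [f [[t X, X], [0, 0]]] is constant on
    circles [|t| = const], so by holomorphy it is constant, and comparing [t = 1]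
    with [t = 0] makes [f] homogeneous, hence linear, near [0].  The identity
    theorem propagates this along the connected set [U n]. *)
Require Import Defs.
From HB Require Import structures.
From mathcomp Require Import all_boot all_order all_algebra.
From mathcomp Require Import all_classical all_reals all_analysis.
From mathcomp Require Import complex.
From mathcomp Require Import ring lra.
Import Order.TTheory GRing.Theory Num.Theory.
Import numFieldNormedType.Exports.
Local Open Scope ring_scope.
Local Open Scope classical_set_scope.
Set Implicit Arguments.
Unset Strict Implicit.
Unset Printing Implicit Defensive.
Import ComplexField.Normc.
Local Open Scope complex_scope.
Local Arguments normc : simpl never.
Local Notation Re := complex.Re.
Local Notation Im := complex.Im.

(** * Maximum principle and identity theorem *)

Section ComplexModulus.
Variable R : realType.
Implicit Types (z w : R[i]) (e d : R).

Lemma normCE z : `|z| = (normc z)%:C.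
Proof. by []. Qed.

Lemma normc_ge0 z : 0 <= normc z.
Proof. by case: z => x y; rewrite /normc sqrtr_ge0. Qed.

Lemma sqr_normcE z : normc z ^+ 2 = Re z ^+ 2 + Im z ^+ 2.
Proof. by case: z => x y; rewrite /normc sqr_sqrtr // addr_ge0 ?sqr_ge0. Qed.

Lemma normc_real e : normc e%:C = `|e|.
Proof. by rewrite /normc /= expr0n addr0 sqrtr_sqr. Qed.

Lemma normcB z w : normc (z - w) = normc (w - z).
Proof. by rewrite -normcN opprB. Qed.

Lemma normc_eq0 z : (normc z == 0) = (z == 0).
Proof.
by apply/eqP/eqP => [/eq0_normc //|->]; rewrite normc0.
Qed.

Lemma normc_gt0 z : (0 < normc z) = (z != 0).
Proof. by rewrite lt_neqAle normc_ge0 andbT eq_sym normc_eq0. Qed.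

Lemma normcX z k : normc (z ^+ k) = normc z ^+ k.
Proof. by elim: k => [|k IH]; rewrite ?normc1 // !exprS normcM IH. Qed.

Lemma normr_Re_le z : `|Re z| <= normc z.
Proof.
rewrite -(@ler_pXn2r _ 2) ?nnegrE ?normc_ge0 // sqr_normcE real_normK ?num_real //.
by rewrite lerDl sqr_ge0.
Qed.

Lemma normr_Im_le z : `|Im z| <= normc z.
Proof.
rewrite -(@ler_pXn2r _ 2) ?nnegrE ?normc_ge0 // sqr_normcE real_normK ?num_real //.
by rewrite lerDr sqr_ge0.
Qed.

End ComplexModulus.

Section IdentityPrinciple.
Variable R : realType.
Implicit Types (z w : R[i]) (e d r : R) (h k : R[i] -> R[i]).

Definition continuous_at0 (c : R[i] -> R[i]) : Prop := forall e, 0 < e ->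
  exists2 d, 0 < d & forall w, normc w < d -> normc (c w - c 0) < e.

(* A second-order complex Taylor expansion is what the mean over the four
   points [z +- s], [z +- i s] sees, and it is all the maximum principle needs. *)
Definition taylor2 h z : Prop := exists b (c : R[i] -> R[i]),
  continuous_at0 c /\
  exists2 r, 0 < r & forall w, normc w < r -> h (z + w) = h z + w * b + w ^+ 2 * c w.

Lemma continuous_at0_id : continuous_at0 id.
Proof. by move=> e e0; exists e => // w; rewrite subr0. Qed.

Lemma continuous_at0_cst x : continuous_at0 (fun=> x).
Proof. by move=> e e0; exists 1 => // w _; rewrite subrr normc0. Qed.

Lemma continuous_at0D h k : continuous_at0 h -> continuous_at0 k ->
  continuous_at0 (fun w => h w + k w).
Proof.
move=> ch ck e e0; have e2 : 0 < e / 2 by rewrite divr_gt0.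
have [d d0 hd] := ch _ e2; have [d' d'0 kd] := ck _ e2.
exists (Num.min d d'); first by rewrite lt_min d0.
move=> w; rewrite lt_min => /andP [/hd h1 /kd h2].
rewrite opprD addrACA; have := le_normcD (h w - h 0) (k w - k 0); lra.
Qed.

Lemma continuous_at0M h k : continuous_at0 h -> continuous_at0 k ->
  continuous_at0 (fun w => h w * k w).
Proof.
move=> ch ck e e0; set A := normc (h 0) + normc (k 0) + 1.
have h00 := normc_ge0 (h 0); have k00 := normc_ge0 (k 0).
have A0 : 0 < A by rewrite /A; lra.
have m0 : 0 < Num.min 1 (e / A) by rewrite lt_min ltr01 divr_gt0.
have [d d0 hd] := ch _ m0; have [d' d'0 kd] := ck _ m0.
exists (Num.min d d'); first by rewrite lt_min d0.
move=> w; rewrite lt_min => /andP [/hd + /kd].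
rewrite !lt_min => /andP [h1 he] /andP [k1 ke].
move: he ke; rewrite !ltr_pdivlMr // => he ke.
have -> : h w * k w - h 0 * k 0 = (h w - h 0) * (k w - k 0)
    + (h 0 * (k w - k 0) + (h w - h 0) * k 0) by ring.
have := le_normcD (h 0 * (k w - k 0)) ((h w - h 0) * k 0).
have := le_normcD ((h w - h 0) * (k w - k 0)) (h 0 * (k w - k 0) + (h w - h 0) * k 0).
rewrite !normcM; have := normc_ge0 (h w - h 0); have := normc_ge0 (k w - k 0).
move: h1 he k1 ke; rewrite /A.
set x := normc (h w - _); set y := normc (k w - _); move=> x1 xA y1 yA y0 x0.
set p := normc (h 0); set q := normc (k 0); set z := normc _; set t := normc _.
rewrite -/p -/q in xA yA *.
(* Since [x] and [y] are below [1], the larger of them times [A] bounds the sum of the three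
   terms. *)
have [xy|/ltW yx] := leP x y => u1 u2.
  have : x * q <= y * q by rewrite ler_wpM2r // normc_ge0.
  have : x * y <= y by rewrite ler_piMl // ltW.
  lra.
have : p * y <= p * x by rewrite ler_wpM2l // normc_ge0.
have : x * y <= x by rewrite ler_piMr // ltW.
lra.
Qed.

Lemma continuous_at0_inv z : z != 0 -> continuous_at0 (fun w => (z + w)^-1).
Proof.
move=> z0 e e0; have nz : 0 < normc z by rewrite normc_gt0.
exists (Num.min (normc z / 2) (normc z ^+ 2 * e / 2)).
  by rewrite lt_min !divr_gt0 // mulr_gt0 // exprn_gt0.
move=> w; rewrite lt_min => /andP [w1 w2].
have zw2 : normc z / 2 < normc (z + w).
  by have := le_normcD (z + w) (- w); rewrite addrK normcN; lra.
have zw : z + w != 0 by rewrite -normc_gt0; apply: le_lt_trans zw2; rewrite divr_ge0 // ltW.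
have -> : (z + w)^-1 - (z + 0)^-1 = - w * (z * (z + w))^-1.
  by rewrite addr0; field; rewrite zw z0.
rewrite normcM normcN normcV normcM ltr_pdivrMr ?mulr_gt0 ?normc_gt0 //.
have : e * (normc z * (normc z / 2)) < e * (normc z * normc (z + w)).
  by rewrite !ltr_pM2l.
lra.
Qed.

Lemma taylor2M h k z : taylor2 h z -> taylor2 k z -> taylor2 (fun x => h x * k x) z.
Proof.
move=> [b [c [cc [r r0 hr]]]] [b' [c' [cc' [r' r0' hr']]]].
exists (h z * b' + b * k z).
exists (fun w => h z * c' w + b * b' + c w * k z + w * (b * c' w + c w * b')
                 + w ^+ 2 * (c w * c' w)); split.
  by do ?[apply: continuous_at0D|apply: continuous_at0M|exact: continuous_at0_cst|exact: continuous_at0_id|assumption].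
exists (Num.min r r'); first by rewrite lt_min r0.
by move=> w; rewrite lt_min => /andP [/hr -> /hr' ->]; ring.
Qed.

(** The geometric series stopped after two terms has the exact remainder
    [w ^+ 2 / (z ^+ 2 * (z + w))]. *)
Lemma taylor2_inv z : z != 0 -> taylor2 GRing.inv z.
Proof.
move=> z0; exists (- z ^- 2), (fun w => z ^- 2 * (z + w)^-1); split.
  by apply: continuous_at0M; [exact: continuous_at0_cst|exact: continuous_at0_inv].
exists (normc z); first by rewrite normc_gt0.
move=> w wz; have zw : z + w != 0.
  apply/eqP => zw; have wE : w = - z by apply/eqP; rewrite -addr_eq0 addrC zw.
  by move: wz; rewrite wE normcN ltxx.
by field; rewrite zw z0.
Qed.

Lemma taylor2_mul_invX h z (n : nat) :
  z != 0 -> taylor2 h z -> taylor2 (fun x => h x * x^-1 ^+ n) z.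
Proof.
move=> z0 hz; elim: n => [|n IH].
  by rewrite (_ : (fun x => _) = h) //; apply/funext => x; rewrite expr0 mulr1.
rewrite (_ : (fun x => _) = fun x => (h x * x^-1 ^+ n) * x^-1).
  by apply: taylor2M => //; exact: taylor2_inv.
by apply/funext => x; rewrite exprSr mulrA.
Qed.

Lemma taylor2_continuous h z : taylor2 h z ->
  forall e, 0 < e -> exists2 d, 0 < d &
    forall w, normc w < d -> normc (h (z + w) - h z) < e.
Proof.
move=> [b [c [cc [r r0 hr]]]].
have H : continuous_at0 (fun w => h z + w * b + w ^+ 2 * c w).
  by do ?[apply: continuous_at0D|apply: continuous_at0M|exact: continuous_at0_cst|exact: continuous_at0_id|assumption].
move=> e /H [d d0 dP]; exists (Num.min d r); first by rewrite lt_min d0.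
move=> w; rewrite lt_min => /andP [wd wr]; rewrite hr //.
by have := dP w wd; rewrite mul0r addr0 expr0n mul0r addr0.
Qed.

(** Parseval for the fourth roots of unity: [1], [w] and [w ^+ 2] are orthogonal on the four points,
    so all cross terms cancel. *)
Lemma four_point_mean (a b c : R[i]) (s : R) :
  let p w := normc (a + w * b + w ^+ 2 * c) ^+ 2 in
  p s%:C + p (- s%:C) + p (s *i) + p (- (s *i)) =
  4 * (normc a ^+ 2 + s ^+ 2 * normc b ^+ 2 + s ^+ 4 * normc c ^+ 2).
Proof.
move=> p; rewrite /p {p} !sqr_normcE; case: a b c => [a1 a2] [b1 b2] [c1 c2].
rewrite !expr2 /=; ring.
Qed.

(** By [four_point_mean], the mean of [|h|^2] over the four points at distance [s] is at least
    [|h z|^2 - s^2 e / 2], whereas the mean of [e |.|^2] exceeds its value at [z] by exactly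
    [e s^2]. This extra term makes the maximum principle strict. *)
Lemma no_local_max h z e r : taylor2 h z -> 0 < e -> 0 < r ->
  exists2 w, normc w < r &
    normc (h z) ^+ 2 + e * normc z ^+ 2
      < normc (h (z + w)) ^+ 2 + e * normc (z + w) ^+ 2.
Proof.
move=> [b [c [cc [d d0 hd]]]] e0 r0.
(* [A] bounds the quadratic polynomial [q] below once [s <= 1]; a variation of [c] under
   [e / (4 * A)] then lowers the squared modulus by at most [s ^+ 2 * (e / 2)]. *)
set A := normc (h z) + normc b + normc (c 0) + 1.
have A0 : 0 < A by rewrite !ltr_wpDl ?addr_ge0 ?normc_ge0.
have [d' d'0 cd'] := cc (e / (4 * A)) ltac:(by rewrite divr_gt0 // mulr_gt0).
pose s := Num.min (Num.min 1 r) (Num.min d d') / 2.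
have m0 : 0 < Num.min (Num.min 1 r) (Num.min d d') by rewrite !lt_min ltr01 r0 d0.
have s0 : 0 < s by rewrite divr_gt0.
have : s < Num.min (Num.min 1 r) (Num.min d d') by rewrite /s; lra.
rewrite !lt_min => /andP [/andP [s1 sr] /andP [sd sd']].
(* The mean value identity needs a constant quadratic coefficient, hence [c] is frozen at [0]. *)
set q := fun w => h z + w * b + w ^+ 2 * c 0.
have key w : normc w = s ->
    normc (q w) ^+ 2 - s ^+ 2 * (e / 2) <= normc (h (z + w)) ^+ 2.
  move=> ws; have wd : normc w < d by rewrite ws.
  have hE : h (z + w) = q w + w ^+ 2 * (c w - c 0) by rewrite hd // /q; ring.
  have n1 : normc (q w) <= A.
    have n2 := le_normcD (h z + w * b) (w ^+ 2 * c 0).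
    have n3 := le_normcD (h z) (w * b).
    move: n2 n3; rewrite !normcM !ws -/(q w).
    have : s * normc b <= normc b by rewrite ler_piMl ?normc_ge0 // ltW.
    have : s * s * normc (c 0) <= normc (c 0).
      by rewrite ler_piMl ?normc_ge0 // mulr_ile1 // ltW.
    rewrite /A; lra.
  have := cd' w ltac:(by rewrite ws).
  set t := normc (c w - c 0) => ht.
  have t0 : 0 <= t by exact: normc_ge0.
  have hA : t * A * 4 <= e.
    by move/ltW: ht; rewrite ler_pdivlMr ?mulr_gt0 //; lra.
  have : normc (q w) <= normc (h (z + w)) + s ^+ 2 * t.
    have -> : q w = h (z + w) - w ^+ 2 * (c w - c 0) by rewrite hE addrK.
    by have := le_normcD (h (z + w)) (- (w ^+ 2 * (c w - c 0)));
       rewrite normcN !normcM !ws -expr2.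
  set x := normc (h (z + w)); set y := normc (q w) => xy.
  have x0 : 0 <= x by exact: normc_ge0.
  have y0 : 0 <= y by exact: normc_ge0.
  have s2 : 0 <= s ^+ 2 by exact: sqr_ge0.
  have : y ^+ 2 - 2 * y * (s ^+ 2 * t) <= x ^+ 2.
    have [yu|yu] := leP (s ^+ 2 * t) y; last by nra.
    have : (y - s ^+ 2 * t) ^+ 2 <= x ^+ 2.
      by rewrite ler_pXn2r ?nnegrE ?subr_ge0 //; lra.
    have : 0 <= (s ^+ 2 * t) ^+ 2 by exact: sqr_ge0.
    rewrite sqrrB; lra.
  have : y * (s ^+ 2 * t) * 4 <= s ^+ 2 * e.
    apply: le_trans (_ : A * (s ^+ 2 * t) * 4 <= _).
      by rewrite ler_pM2r // ler_wpM2r // mulr_ge0.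
    have := ler_wpM2l s2 hA; lra.
  lra.
have mean := four_point_mean (h z) b (c 0) s; rewrite /= in mean.
have mean1 := four_point_mean z 1 0 s.
rewrite /= !mulr1 !mulr0 !addr0 (normc1 R) (normc0 R) in mean1.
have k1 := key (s%:C) ltac:(by rewrite normc_real gtr0_norm).
have k2 := key (- s%:C) ltac:(by rewrite normcN normc_real gtr0_norm).
have ni : normc (s *i) = s by rewrite /normc /= expr0n add0r sqrtr_sqr gtr0_norm.
have k3 := key (s *i) ni.
have k4 := key (- (s *i)) ltac:(by rewrite normcN).
apply: contrapT => H.
have {}H w : normc w = s ->
    normc (h (z + w)) ^+ 2 + e * normc (z + w) ^+ 2
    <= normc (h z) ^+ 2 + e * normc z ^+ 2.
  by move=> ws; rewrite leNgt; apply/negP => ?; apply: H; exists w => //; rewrite ws.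
have h1 := H (s%:C) ltac:(by rewrite normc_real gtr0_norm).
have h2 := H (- s%:C) ltac:(by rewrite normcN normc_real gtr0_norm).
have h3 := H (s *i) ni.
have h4 := H (- (s *i)) ltac:(by rewrite normcN).
have b0 : 0 <= s ^+ 2 * normc b ^+ 2 by rewrite mulr_ge0 ?sqr_ge0.
have c0 : 0 <= s ^+ 4 * normc (c 0) ^+ 2 by rewrite mulr_ge0 ?exprn_ge0 ?normc_ge0 // ltW.
have es : 0 < e * s ^+ 2 by rewrite mulr_gt0 ?exprn_gt0.
move: mean k1 k2 k3 k4; rewrite /q.
set y1 := normc _ ^+ 2; set y2 := normc _ ^+ 2; set y3 := normc _ ^+ 2; set y4 := normc _ ^+ 2.
move=> mean k1 k2 k3 k4.
have {}mean1 := congr1 (fun x => e * x) mean1; rewrite /= in mean1.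
lra.
Qed.

Lemma normcB_ge z w : `|normc z - normc w| <= normc (w - z).
Proof.
have h1 := le_normcD (w - z) z; have h2 := le_normcD (z - w) w.
rewrite subrK in h1; rewrite subrK normcB in h2.
by rewrite ler_norml; lra.
Qed.

Lemma emb_lt (p : R * R) d : 0 < d ->
  \forall q \near p, normc ((q.1 +i* q.2) - (p.1 +i* p.2)) < d.
Proof.
move=> d0; have d2 : 0 < d / 2 by rewrite divr_gt0.
apply/nbhs_ballP; exists (d / 2) => // q [/= h1 h2].
set z := _ - _; have -> : z = (Re z)%:C + (Im z) *i.
  by case: z => a b; apply/eqP; rewrite eq_complex /= addr0 add0r !eqxx.
apply: le_lt_trans (le_normcD _ _) _.
rewrite normc_real (_ : normc (_ *i) = `|Im z|); last first.
  by rewrite /normc /= expr0n add0r sqrtr_sqr.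
have : `|Re z| < d / 2 by rewrite /z /= distrC.
have : `|Im z| < d / 2 by rewrite /z /= distrC.
lra.
Qed.

(** With half-side [2] the point [1] is inside while [|z| >= 2] on the boundary; this ratio drives
    [identity_principle]. *)
Definition square z : Prop := `|Re z| <= 2 /\ `|Im z| <= 2.

(** A maximizer of [|h|^2 + e |z|^2] on the compact square must lie on the boundary by
    [no_local_max]. As [|z|^2 <= 8] there, letting [e] tend to [0] gives the bound. *)
Lemma square_max h (B : R) :
  (forall z, square z -> taylor2 h z) ->
  (forall z, square z -> `|Re z| = 2 \/ `|Im z| = 2 -> normc (h z) <= B) ->
  forall z, square z -> normc (h z) <= B.
Proof.
move=> th hB z sz.
have B0 : 0 <= B.
  apply: le_trans (normc_ge0 (h (2 +i* 0))) (hB _ _ _).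
    by split; rewrite /= ?normr0 ?ger0_norm.
  by left; rewrite /= ger0_norm.
suff H e : 0 < e -> normc (h z) ^+ 2 <= B ^+ 2 + 8 * e.
  rewrite -(@ler_pXn2r _ 2) ?nnegrE ?normc_ge0 //; apply/ler_addgt0Pr => e e0.
  by have := H (e / 8) ltac:(by rewrite divr_gt0); lra.
move=> e0.
pose S := (`[(-2 : R), 2] `*` `[(-2 : R), 2])%classic.
pose emb (p : R * R) := p.1 +i* p.2.
pose u (p : R * R) := normc (h (emb p)) ^+ 2 + e * normc (emb p) ^+ 2.
have SP p : S p <-> square (emb p).
  rewrite /S /square /= !in_itv /= !ler_norml; split=> [[-> ->]|[]] //.
have uc : {within S, continuous u}.
  apply: continuous_in_subspaceT => p; rewrite inE => /SP sp.
  have nc : continuous_at p (@normc R \o h \o emb).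
    apply/cvgrPdist_lt => eta eta0.
    have [d d0 hd] := taylor2_continuous (th _ sp) eta0.
    apply: filterS (emb_lt p d0) => q /hd; rewrite (addrC (emb p)) subrK /=.
    exact: le_lt_trans (normcB_ge _ _).
  have ec : continuous_at p (@normc R \o emb).
    apply/cvgrPdist_lt => eta eta0.
    apply: filterS (emb_lt p eta0) => q /=.
    exact: le_lt_trans (normcB_ge _ _).
  apply: cvgD; first by apply: (@continuous_comp _ _ _ _ (fun x : R => x ^+ 2)) nc _; exact: exprn_continuous.
  apply: cvgM; first exact: cvg_cst.
  by apply: (@continuous_comp _ _ _ _ (fun x : R => x ^+ 2)) ec _; exact: exprn_continuous.
have Sc : compact S by apply: compact_setX; exact: segment_compact.
have S0 : S !=set0.
  by exists (0, 0); apply/SP; split; rewrite /= normr0.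
have [p0 p0S p0M] := compact_EVT_max S0 Sc uc.
move: p0S; rewrite inE => /SP sp0.
have uz w : square w -> normc (h w) ^+ 2 + e * normc w ^+ 2 <= u p0.
  move=> sw; have := p0M (Re w, Im w); rewrite inE /u /emb /=.
  by case: w sw => a b sw; apply; apply/SP.
have n8 w : square w -> normc w ^+ 2 <= 8.
  case=> a b; rewrite sqr_normcE.
  have : `|Re w| ^+ 2 <= 2 ^+ 2 by rewrite ler_pXn2r ?nnegrE.
  have : `|Im w| ^+ 2 <= 2 ^+ 2 by rewrite ler_pXn2r ?nnegrE.
  rewrite !real_normK ?num_real //; lra.
have [bd|int] := pselect (`|Re (emb p0)| = 2 \/ `|Im (emb p0)| = 2).
  have := uz z sz; rewrite /u; have := hB _ sp0 bd; have := n8 _ sp0.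
  move=> h8 hb; have : normc (h (emb p0)) ^+ 2 <= B ^+ 2.
    by rewrite ler_pXn2r ?nnegrE ?normc_ge0.
  have : 0 <= e * normc z ^+ 2 by rewrite mulr_ge0 ?sqr_ge0 // ltW.
  have : e * normc (emb p0) ^+ 2 <= e * 8 by rewrite ler_pM2l.
  lra.
have [sx sy] := sp0.
have lx : `|Re (emb p0)| < 2 by rewrite lt_neqAle sx andbT; apply/eqP; tauto.
have ly : `|Im (emb p0)| < 2 by rewrite lt_neqAle sy andbT; apply/eqP; tauto.
pose r := Num.min (2 - `|Re (emb p0)|) (2 - `|Im (emb p0)|).
have r0 : 0 < r by rewrite lt_min !subr_gt0 lx.
have [w wr] := no_local_max (th _ sp0) e0 r0.
suff sw : square (emb p0 + w) by have := uz _ sw; rewrite /u; lra.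
move: wr; rewrite lt_min => /andP [wx wy].
have := normr_Re_le w; have := normr_Im_le w.
have -> : square (emb p0 + w) =
  (`|Re (emb p0) + Re w| <= 2 /\ `|Im (emb p0) + Im w| <= 2) by case: (w).
have := ler_normD (Re (emb p0)) (Re w); have := ler_normD (Im (emb p0)) (Im w).
by move=> *; split; lra.
Qed.

(** Schwarz-type argument: [h x / x ^+ n] still has second-order expansions and is at most
    [M / 2 ^+ n] on the boundary of the square, so [|h 1| <= M / 2 ^+ n] for every [n]. *)
Lemma identity_principle h (M r : R) : 0 < r ->
  (forall z, square z -> taylor2 h z) ->
  (forall z, square z -> normc (h z) <= M) ->
  (forall z, normc z < r -> h z = 0) ->
  h 1 = 0.
Proof.
move=> r0 th hM hr.
have s1 : square 1 by split; rewrite /= ?normr0 ?normr1 // ler1n.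
have M0 : 0 <= M by exact: le_trans (normc_ge0 _) (hM _ s1).
have H n : normc (h 1) <= M / 2 ^+ n.
  have := @square_max (fun x => h x * x^-1 ^+ n) (M / 2 ^+ n) _ _ 1 s1.
  rewrite invr1 expr1n mulr1; apply.
    move=> z sz; have [z0|z0] := eqVneq z 0; last first.
      exact: taylor2_mul_invX z0 (th _ sz).
    (* At [z = 0] the quotient vanishes on a whole disc because [h] does, whatever the value of
       [0^-1]. *)
    exists 0, (fun=> 0); split; first exact: continuous_at0_cst.
    exists r => // w wr; rewrite z0 add0r (hr w wr) (hr 0) ?normc0 //.
    by rewrite !mul0r !mulr0 !addr0.
  move=> z sz bd; rewrite normcM normcX normcV exprVn ler_pM ?invr_ge0 ?exprn_ge0 ?normc_ge0 ?hM //.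
  have z2 : 2 <= normc z.
    by case: bd => <-; [exact: normr_Re_le|exact: normr_Im_le].
  have z0 : 0 < normc z by lra.
  by rewrite lef_pV2 ?posrE ?exprn_gt0 // lerXn2r ?nnegrE // ltW.
apply: eq0_normc; apply/eqP; rewrite eq_le normc_ge0 andbT.
apply/ler_addgt0Pr => e e0; rewrite add0r.
have [n nM] : exists n : nat, M / e < n%:R.
  by exists (Num.bound (M / e)); apply: le_lt_trans (archi_boundP _) => //; rewrite divr_ge0 // ltW.
apply: le_trans (H n) _; rewrite ler_pdivrMr ?exprn_gt0 //.
move: nM; rewrite ltr_pdivrMr // => /ltW nM; apply: le_trans nM _.
by rewrite mulrC ler_pM2l // -natrX ler_nat ltnW // ltn_expl.
Qed.

End IdentityPrinciple.

(** * Free maps on block upper triangular tuples *)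

Section FreeCalculus.
Variables (R : realType) (g h : nat).

(** Tuples as families of components, so that block matrix calculus applies to each component; [tmk]
    and [tcomp] pass to and from the block-row encoding. *)
Definition mxfam (k n : nat) := 'I_k -> 'M[R[i]]_n.

Definition scalef k n (c : R[i]) (X : mxfam k n) : mxfam k n := fun j => c *: X j.

Definition intertwines k n m (X : mxfam k n) (Y : mxfam k m) (G : 'M[R[i]]_(n, m)) : Prop :=
  forall j, X j *m G = G *m Y j.

Definition upper_block k n m (X : mxfam k n) (H : 'I_k -> 'M[R[i]]_(n, m))
  (Y : mxfam k m) : mxfam k (n + m) := fun j => block_mx (X j) (H j) 0 (Y j).

Definition cube k n m (d : R) (X : 'I_k -> 'M[R[i]]_(n, m)) : Prop :=
  forall j a b, normc (X j a b) < d.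

Definition free_on (U : forall n, mxfam g n -> Prop)
  (F : forall n, mxfam g n -> mxfam h n) : Prop :=
  forall n m (X : mxfam g n) (Y : mxfam g m) G, U n X -> U m Y ->
    intertwines X Y G -> intertwines (F n X) (F m Y) G.

Lemma block_mx_ind (P : R[i] -> Prop) n1 n2 m1 m2
    (A : 'M[R[i]]_(n1, m1)) (B : 'M[R[i]]_(n1, m2)) (C : 'M[R[i]]_(n2, m1)) (D : 'M[R[i]]_(n2, m2)) :
  (forall a b, P (A a b)) -> (forall a b, P (B a b)) ->
  (forall a b, P (C a b)) -> (forall a b, P (D a b)) ->
  forall a b, P (block_mx A B C D a b).
Proof.
move=> hA hB hC hD a b.
by case: (split_ordP a) => a' ->; case: (split_ordP b) => b' ->;
   rewrite ?block_mxEul ?block_mxEur ?block_mxEdl ?block_mxEdr.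
Qed.

Lemma row_mx_ind (P : R[i] -> Prop) n m1 m2 (A : 'M[R[i]]_(n, m1)) (B : 'M[R[i]]_(n, m2)) :
  (forall a b, P (A a b)) -> (forall a b, P (B a b)) ->
  forall a b, P (row_mx A B a b).
Proof.
by move=> hA hB a b; case: (split_ordP b) => b' ->;
   rewrite ?row_mxEl ?row_mxEr.
Qed.

Lemma cube_upper_block k n m d (X : mxfam k n) H (Y : mxfam k m) :
  0 < d -> cube d X -> cube d H -> cube d Y -> cube d (upper_block X H Y).
Proof.
move=> d0 hX hH hY j; apply: (@block_mx_ind (fun z => normc z < d)); rewrite //.
by move=> a b; rewrite mxE normc0.
Qed.

Lemma cube0 k n m d : 0 < d -> cube d (fun _ : 'I_k => 0 : 'M[R[i]]_(n, m)).
Proof. by move=> d0 j a b; rewrite mxE normc0. Qed.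

Lemma cube_le k n m d d' (X : 'I_k -> 'M[R[i]]_(n, m)) : d <= d' -> cube d X -> cube d' X.
Proof. by move=> dd hX j a b; apply: lt_le_trans dd. Qed.

Section FreeMap.
Variables (U : forall n, mxfam g n -> Prop) (F : forall n, mxfam g n -> mxfam h n).
Arguments U {n}.
Arguments F {n}.
Hypothesis freeF : free_on (@U) (@F).

(** The inclusion column intertwines the block tuple with [X], and the projection row intertwines
    [Y] with it; they determine the first block column and the last block row of the value. *)
Lemma free_upper_block n m (X : mxfam g n) H (Y : mxfam g m) :
  U (upper_block X H Y) -> U X -> U Y -> forall j,
  F (upper_block X H Y) j =
    block_mx (F X j) (ursubmx (F (upper_block X H Y) j)) 0 (F Y j).
Proof.
move=> UZ UX UY j; set Z := F _ _.
have h1 : Z *m col_mx 1%:M 0 = col_mx 1%:M 0 *m F X j.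
  apply: freeF => // i.
  by rewrite mul_block_col mul_col_mx !mulmx1 mul1mx !mulmx0 !mul0mx !addr0.
have h2 : F Y j *m row_mx 0 1%:M = row_mx 0 1%:M *m Z.
  apply: freeF => // i.
  by rewrite mul_mx_row mul_row_block mulmx0 mulmx1 !mul0mx !mul1mx !add0r.
rewrite -[LHS]submxK; move: h1 h2; rewrite -{1 2}[Z]submxK.
rewrite mul_block_col mul_col_mx !mulmx1 mul1mx !mulmx0 mul0mx !addr0.
rewrite mul_mx_row mul_row_block mulmx0 mulmx1 !mul0mx !mul1mx !add0r.
by move=> /eq_col_mx [-> ->] /eq_row_mx [_ <-].
Qed.

(** The column with blocks [- s] and [1] intertwines [Z] with [Y]; the upper block of the resulting
    identity turns the corner into a difference of values. *)
Lemma free_corner n (X Y : mxfam g n) (s : R[i]) :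
  let Z := upper_block X (fun j => s *: (X j - Y j)) Y in
  U Z -> U X -> U Y -> forall j, ursubmx (F Z j) = s *: (F X j - F Y j).
Proof.
move=> Z UZ UX UY j.
have : F Z j *m col_mx (- s)%:M 1%:M = col_mx (- s)%:M 1%:M *m F Y j.
  apply: freeF => // i.
  rewrite mul_block_col mul_col_mx !mulmx1 mul1mx mul0mx add0r.
  rewrite mul_mx_scalar mul_scalar_mx; congr col_mx.
  by rewrite scalerBr scaleNr addrA addNr add0r scaleNr.
rewrite [F Z j]free_upper_block // mul_block_col mul_col_mx !mulmx1.
move=> /eq_col_mx [+ _]; rewrite mul_mx_scalar mul_scalar_mx -/Z => E.
rewrite -[LHS](addKr (- s *: F X j)) block_mxKur {}E.
by rewrite scalerBr !scaleNr opprK.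
Qed.

(** A large multiple of [P - Q] fits in the corner of a block tuple in [U], and the bound [M] on the
    value there bounds the same multiple of [F P - F Q]. The constant depends on [M] and [d] only,
    hence serves all iterates of a self-map. *)
Lemma free_lipschitz n (d M e : R) (P Q : mxfam g n) :
  0 < d -> 0 < e ->
  (forall m (X : mxfam g m), U X -> forall j a b, normc (F X j a b) <= M) ->
  (forall X : mxfam g n, cube d X -> U X) ->
  (forall X : mxfam g (n + n), cube d X -> U X) ->
  cube d P -> cube d Q -> (forall j a b, normc (P j a b - Q j a b) <= e) ->
  forall j a b, normc (F P j a b - F Q j a b) <= 2 * M / d * e.
Proof.
move=> d0 e0 bF U1 U2 cP cQ PQ j a b.
(* This factor shrinks or stretches differences of size at most [e] to size at most [d / 2]. *)
pose s : R[i] := (d / (2 * e))%:C.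
have ns : normc s = d / (2 * e) by rewrite normc_real ger0_norm // divr_ge0 ?mulr_ge0 ?ltW.
have UZ : U (upper_block P (fun j => s *: (P j - Q j)) Q).
  apply: U2; apply: cube_upper_block => // i a' b'.
  rewrite !mxE normcM ns; apply: (@le_lt_trans _ _ (d / (2 * e) * e)).
    by rewrite ler_wpM2l // divr_ge0 ?mulr_ge0 ?ltW.
  have -> : d / (2 * e) * e = d / 2 by field; lra.
  lra.
have := bF _ _ UZ j (lshift n a) (rshift n b).
have -> : F (upper_block P (fun j => s *: (P j - Q j)) Q) j (lshift n a) (rshift n b)
    = ursubmx (F (upper_block P (fun j => s *: (P j - Q j)) Q) j) a b.
  by rewrite !mxE.
rewrite free_corner ?U1 //; try exact: U1.
rewrite !mxE normcM ns => hM.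
have -> : 2 * M / d * e = M / (d / (2 * e)) by field; lra.
by rewrite ler_pdivlMr ?divr_gt0 ?mulr_gt0 // mulrC.
Qed.

(** The matrix [diag(c, 1)] intertwines the two shifts, and since [F] maps [0] to [0] only the
    corner of each value survives. *)
Lemma free_shift_homogeneous n m (K : 'I_g -> 'M[R[i]]_(n, m)) (c : R[i]) :
  (forall k j, F (fun=> 0 : 'M[R[i]]_k) j = 0) -> (forall k, U (fun=> 0 : 'M[R[i]]_k)) ->
  U (upper_block (fun=> 0) K (fun=> 0)) ->
  U (upper_block (fun=> 0) (fun j => c *: K j) (fun=> 0)) -> forall j,
  F (upper_block (fun=> 0) (fun j => c *: K j) (fun=> 0)) j
    = c *: F (upper_block (fun=> 0) K (fun=> 0)) j.
Proof.
move=> F0 U0 UK UcK j.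
have : F (upper_block (fun=> 0) (fun j => c *: K j) (fun=> 0)) j *m block_mx c%:M 0 0 1%:M =
       block_mx c%:M 0 0 1%:M *m F (upper_block (fun=> 0) K (fun=> 0)) j.
  apply: freeF => // i; rewrite !mulmx_block !mulmx0 !mul0mx !mulmx1 !addr0 !add0r.
  by rewrite mul_scalar_mx.
have shape (K' : 'I_g -> 'M[R[i]]_(n, m)) : U (upper_block (fun=> 0) K' (fun=> 0)) ->
    exists w, F (upper_block (fun=> 0) K' (fun=> 0)) j = block_mx 0 w 0 0.
  move=> UK'; exists (ursubmx (F (upper_block (fun=> 0) K' (fun=> 0)) j)).
  by rewrite {1}free_upper_block // !F0.
have [w ->] := shape _ UcK; have [z ->] := shape _ UK.
rewrite !mulmx_block !mulmx0 !mul0mx !mulmx1 !addr0 !add0r mul_scalar_mx.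
by rewrite scale_block_mx !scaler0 => /eq_block_mx [_ -> _ _].
Qed.

(** The column [(1, w, w^2)] intertwines [T] with [Pw], so the first block row of [F T] is a Taylor
    expansion. The first two block columns intertwine [T] with [[[P, H], [0, P]]], so the two
    leading coefficients do not depend on [w]; the remainder is a block of a value of [F]. *)
Lemma free_taylor n (P H : mxfam g n) (w : R[i]) :
  let Pw : mxfam g n := fun j => P j + w *: H j in
  let T := upper_block P (fun j => row_mx (H j) 0) (upper_block P H Pw) in
  U T -> U Pw -> U (upper_block P H P) -> forall j,
  F Pw j = ulsubmx (F (upper_block P H P) j)
           + w *: ursubmx (F (upper_block P H P) j)
           + w ^+ 2 *: rsubmx (ursubmx (F T j)).
Proof.
move=> Pw T UT UPw UP j.
have h1 : F T j *m col_mx 1%:M (col_mx w%:M (w ^+ 2)%:M)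
          = col_mx 1%:M (col_mx w%:M (w ^+ 2)%:M) *m F Pw j.
  apply: freeF => // i; rewrite /T /upper_block mul_block_col mul_row_col mul_block_col.
  rewrite !mul_col_mx !(mul0mx, mulmx1, mul1mx) !add0r addr0 !mul_mx_scalar !mul_scalar_mx.
  congr col_mx; congr col_mx.
  by rewrite /Pw scalerDr scalerA.
have h2 : F T j *m col_mx (row_mx 1%:M 0) (block_mx 0 1%:M 0 0)
     = col_mx (row_mx 1%:M 0) (block_mx 0 1%:M 0 0) *m F (upper_block P H P) j.
  apply: freeF => // i; rewrite /T /upper_block mul_block_col mul_mx_row mul_row_block.
  rewrite !mulmx_block mul_col_mx mul_row_block mulmx_block.
  rewrite ?(mulmx0, mul0mx, mulmx1, mul1mx, addr0, add0r).
  by rewrite add_row_mx addr0 add0r.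
move: h1 h2; set Z := F T j; set Y := F (upper_block P H P) j.
have uE : ursubmx Z = row_mx (lsubmx (ursubmx Z)) (rsubmx (ursubmx Z)) by rewrite hsubmxK.
rewrite -{1 2}[Z]submxK -{1}[Y]submxK !mul_block_col !mul_col_mx.
move=> /eq_col_mx [+ _] /eq_col_mx [+ _].
move: uE; move: (lsubmx _) (rsubmx _) => B C ->.
rewrite mul_row_col mul_mx_row !mul_row_block.
rewrite ?(mulmx0, mul0mx, mulmx1, mul1mx, addr0, add0r) !mul_mx_scalar.
rewrite add_row_mx addr0 add0r => <- /eq_row_mx [-> ->].
by rewrite addrA.
Qed.

End FreeMap.
End FreeCalculus.

(** Dividing by [m] and letting it grow: the form in which linear growth is played against a fixed
    bound. *)
Lemma le_eps_natP (R : realType) (x y c : R) : 0 <= c ->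
  (forall m : nat, m%:R * x <= c + m%:R * y) -> x <= y.
Proof.
move=> c0 H; rewrite leNgt; apply/negP => yx.
have xy0 : 0 < x - y by rewrite subr_gt0.
have := archi_boundP (divr_ge0 c0 (ltW xy0)).
rewrite ltr_pdivrMr // mulrBr; have := H (Num.bound (c / (x - y))).
lra.
Qed.

(** * Iteration of bounded free self-maps fixing the shifts *)

Section SelfMap.
Variables (R : realType) (g : nat) (U : forall n, mxfam R g n -> Prop).
Arguments U {n}.
Variable M : R.
Hypothesis M0 : 0 <= M.
Hypothesis bdU : forall n (X : mxfam R g n), U X -> forall j a b, normc (X j a b) <= M.
Variables (n : nat) (d r : R).
Hypotheses (r0 : 0 < r) (rd : r <= d) (rM : 8 * M * r <= d ^+ 2).
Hypothesis U1 : forall X : mxfam R g n, cube d X -> U X.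
Hypothesis U2 : forall X : mxfam R g (n + n), cube d X -> U X.
Hypothesis U4 : forall X : mxfam R g ((n + n) + (n + n)), cube d X -> U X.

Record shift_fixing (G : forall m, mxfam R g m -> mxfam R g m) : Prop := ShiftFixing {
  sf_free : free_on (@U) G;
  sf_self : forall m (X : mxfam R g m), U X -> U (G m X);
  sf_0 : G n (fun=> 0) = fun=> 0;
  sf_shift : forall K : mxfam R g n, cube d K ->
    G (n + n)%N (upper_block (fun=> 0) K (fun=> 0)) = upper_block (fun=> 0) K (fun=> 0)
}.

(** Gives every iterate the estimate below with the same constants [M], [d] and [r]. *)
Lemma shift_fixing_iter G k :
  shift_fixing G -> shift_fixing (fun m X => iter k (G m) X).
Proof.
move=> [Gf GU G0 GK].
have GkU m (X : mxfam R g m) i : U X -> U (iter i (G m) X).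
  by move=> UX; elim: i => //= i IH; exact: GU.
split; first 1 last.
- by move=> m X; exact: GkU.
- by elim: k => //= k ->.
- by move=> K cK; elim: k => //= k ->; exact: GK.
move=> m p X Y B UX UY XY; elim: k => //= k IH.
by apply: Gf => //; exact: GkU.
Qed.

(** With [K] a multiple of [X - Y], the tuples [[[X, K], [0, Y]]] and [[[0, K], [0, 0]]] are within
    [r] of each other. [G] fixes the second and puts the same multiple of [G X - G Y] in the corner
    of the first, so the uniform Lipschitz bound compares the two differences. *)
Lemma shift_fixing_near_isometry G (X Y : mxfam R g n) e :
  shift_fixing G -> cube r X -> cube r Y -> 0 < e ->
  (forall j a b, normc (X j a b - Y j a b) <= e) ->
  forall j a b, normc ((G n X j a b - G n Y j a b) - (X j a b - Y j a b)) <= e / 2.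
Proof.
move=> sG cX cY e0 XY j a b.
have d0 : 0 < d by exact: lt_le_trans rd.
pose s : R[i] := (d / (2 * e))%:C.
have ns : normc s = d / (2 * e) by rewrite normc_real ger0_norm // divr_ge0 ?mulr_ge0 ?ltW.
pose K : mxfam R g n := fun j => s *: (X j - Y j).
have cK : cube d K.
  move=> i a' b'; rewrite !mxE normcM ns; apply: (@le_lt_trans _ _ (d / (2 * e) * e)).
    by rewrite ler_wpM2l // divr_ge0 ?mulr_ge0 ?ltW.
  have -> : d / (2 * e) * e = d / 2 by field; lra.
  lra.
have [dX dY] := (cube_le rd cX, cube_le rd cY).
have cP : cube d (upper_block X K Y) by exact: cube_upper_block.
have cQ : cube d (upper_block (fun=> 0) K (fun=> 0) : mxfam R g (n + n)).
  by apply: cube_upper_block => //; exact: cube0.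
have PQ i a' b' : normc (upper_block X K Y i a' b' -
    upper_block (fun=> 0) K (fun=> 0) i a' b') <= r.
  rewrite /upper_block; case: (split_ordP a') => a1 ->; case: (split_ordP b') => b1 ->;
    rewrite ?block_mxEul ?block_mxEur ?block_mxEdl ?block_mxEdr ?subrr ?normc0 ?(ltW r0) //;
    rewrite [X in _ - X]mxE subr0.
  - exact: ltW (cX i a1 b1).
  - exact: ltW (cY i a1 b1).
have bG m (Z : mxfam R g m) : U Z -> forall j a b, normc (G m Z j a b) <= M.
  by move=> UZ; apply: bdU; exact: (sf_self sG).
have := free_lipschitz (sf_free sG) d0 r0 bG U2 U4 cP cQ PQ j (lshift n a) (rshift n b).
rewrite (sf_shift sG) // /upper_block block_mxEur.
have -> : G (n + n)%N (upper_block X K Y) j (lshift n a) (rshift n b)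
    = ursubmx (G (n + n)%N (upper_block X K Y) j) a b by rewrite !mxE.
rewrite (free_corner (sf_free sG)) ?U1 //; try exact: U2; try exact: U1.
rewrite !mxE -mulrBr normcM ns => H.
(* [rM] brings the Lipschitz bound [2 * M / d * r] down to [d / 4], which is [e / 2] after division
   by [s]. *)
have {}H : d / (2 * e) * normc (G n X j a b - G n Y j a b - (X j a b - Y j a b)) <= d / 4.
  apply: le_trans H _.
  have -> : 2 * M / d * r = 8 * M * r / (4 * d) by field; lra.
  have d4 : d / 4 * (4 * d) = d ^+ 2 by field.
  by rewrite ler_pdivrMr ?mulr_gt0 // d4.
have -> : e / 2 = d / 4 / (d / (2 * e)) by field; lra.
by rewrite ler_pdivlMr ?divr_gt0 ?mulr_gt0 // mulrC.
Qed.

(* If [X <> G X], the iterates of [G] would drift away from [X] at linear speed,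
   since each of them nearly preserves the difference [X - G X]; but [U] is bounded. *)
Lemma shift_fixing_id G (X : mxfam R g n) : shift_fixing G -> cube (r / 2) X -> G n X = X.
Proof.
move=> sG cX; have d0 : 0 < d by exact: lt_le_trans rd.
have r2 : r / 2 <= r by have := r0; lra.
have rX : cube r X by exact: cube_le cX.
have UX : U X by apply: U1; exact: cube_le rX.
(* Taking [Y = 0] in the near-isometry, [G] moves [X] by at most [r / 4], so [G n X] stays where the
   estimate applies. *)
have rGX : cube r (G n X).
  move=> j a b.
  have := shift_fixing_near_isometry (Y := fun=> 0) (e := r / 2) sG rX (@cube0 _ _ _ _ _ r0)
    ltac:(by rewrite divr_gt0) _ j a b.
  rewrite (sf_0 sG) !mxE !subr0 => /(_ _) H.
  have {}H : normc (G n X j a b - X j a b) <= r / 2 / 2.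
    by apply: H => i a' b'; rewrite mxE subr0 ltW.
  have := le_normcD (G n X j a b - X j a b) (X j a b); rewrite subrK.
  have := cX j a b; have := r0; lra.
have halve e : 0 < e -> (forall j a b, normc (X j a b - G n X j a b) <= e) ->
    forall j a b, normc (X j a b - G n X j a b) <= e / 2.
  move=> e0 He j a b.
  apply: (@le_eps_natP _ _ _ (2 * M)); first by rewrite mulr_ge0.
  move=> m; pose w : R[i] := X j a b - G n X j a b.
  (* The near-isometry of each iterate on the pair [X], [G n X] contributes an error [e / 2], and
     the sum telescopes. *)
  have tele : normc (X j a b - iter m (G n) X j a b - m%:R * w) <= m%:R * (e / 2).
    elim: m => [|m IH]; first by rewrite /= subrr !mul0r subrr normc0.
    have := shift_fixing_near_isometry (shift_fixing_iter m sG) rX rGX e0 He j a b.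
    rewrite -iterSr -/w => H.
    have -> : X j a b - iter m.+1 (G n) X j a b - m.+1%:R * w =
       (X j a b - iter m (G n) X j a b - m%:R * w) +
       (iter m (G n) X j a b - iter m.+1 (G n) X j a b - w).
      by rewrite -natr1; ring.
    apply: le_trans (le_normcD _ _) _; rewrite -natr1; lra.
  have UGm := sf_self (shift_fixing_iter m sG) UX.
  have := bdU UX j a b; have := bdU UGm j a b.
  have := le_normcD (X j a b) (- iter m (G n) X j a b); rewrite normcN.
  have := le_normcD (X j a b - iter m (G n) X j a b)
            (- (X j a b - iter m (G n) X j a b - m%:R * w)).
  rewrite normcN opprB addrC subrK normcM.
  have -> : normc (m%:R : R[i]) = m%:R.
    by rewrite -(rmorph_nat (real_complex R)) normc_real ger0_norm.
  rewrite -/w; lra.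
(* Halving starts from [2 * M + 1] rather than [2 * M] because [halve] asks for a positive bound. *)
have small k : forall j a b, normc (X j a b - G n X j a b) <= (2 * M + 1) / 2 ^+ k.
  elim: k => [|k IH] j a b.
    rewrite divr1; have := bdU UX j a b; have := bdU (sf_self sG UX) j a b.
    have := le_normcD (X j a b) (- G n X j a b); rewrite normcN; lra.
  rewrite exprSr invfM mulrA; apply: halve => //.
  by rewrite divr_gt0 ?exprn_gt0 // ltr_wpDl ?mulr_ge0.
apply/funext => j; apply/matrixP => a b; apply/esym/eqP; rewrite -subr_eq0.
apply/eqP/eq0_normc/eqP; rewrite eq_le normc_ge0 andbT.
apply: (@le_eps_natP _ _ _ (2 * M + 1)); first by rewrite addr_ge0 ?mulr_ge0.
move=> m; rewrite mulr0 addr0; set N := normc _.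
apply: (@le_trans _ _ (2 ^+ m * N)).
  by rewrite ler_wpM2r ?normc_ge0 // -natrX ler_nat ltnW // ltn_expl.
by rewrite mulrC -ler_pdivlMr ?exprn_gt0 //; exact: small.
Qed.

End SelfMap.

(** The Cayley transform [(1 + i s) / (1 - i s)] has modulus [1] and lies within [2 s = e] of
    [1]. *)
Lemma unit_complex_near1 (R : realType) (e : R) : 0 < e ->
  exists c : R[i], [/\ normc c = 1, c != 1 & normc (c - 1) <= e].
Proof.
move=> e0; pose s : R := e / 2; have s0 : 0 < s by rewrite divr_gt0.
pose p : R[i] := 1 +i* s; pose q : R[i] := 1 -i* s.
have np : normc p = normc q by rewrite /normc /= sqrrN.
have n1 : 1 <= normc q by apply: le_trans (normr_Re_le q); rewrite /= normr1.
have nq0 : 0 < normc q by exact: lt_le_trans ltr01 n1.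
have q0 : q != 0 by rewrite -normc_gt0.
have pq : p - q = (2 * s) *i by apply/eqP; rewrite eq_complex /= subrr opprK mulr2n mulrDl mul1r !eqxx.
exists (p / q); split.
- by rewrite normcM normcV np mulfV; rewrite ?gt_eqF.
- apply/eqP => E; have : p - q = 0 by rewrite -[p](divfK q0) E mul1r subrr.
  rewrite pq => /eqP; rewrite eq_complex /= => /andP [_].
  by rewrite mulf_eq0 pnatr_eq0 (gt_eqF s0).
- have -> : p / q - 1 = (p - q) / q by rewrite mulrBl mulfV.
  rewrite pq normcM normcV /normc /= expr0n add0r sqrtr_sqr -/(normc q).
  rewrite gtr0_norm ?mulr_gt0 // ler_pdivrMr //.
  have -> : 2 * s = e by rewrite /s; field.
  by rewrite ler_peMr // ltW.
Qed.

(** * Rotation invariance and homogeneity near the origin *)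

Section CircularFreeMaps.
Variables (R : realType) (g gt : nat) (U : forall n, mxfam R g n -> Prop).
Variable f : forall n, mxfam R g n -> mxfam R gt n.
Arguments U {n}.
Arguments f {n}.
Variable M : R.
Hypothesis M0 : 0 <= M.
Hypothesis bdU : forall n (X : mxfam R g n), U X -> forall j a b, normc (X j a b) <= M.
Hypothesis bdf : forall n (X : mxfam R g n), U X -> forall j a b, normc (f X j a b) <= M.
Hypothesis free_f : free_on (@U) (@f).
Hypothesis intertwines_f : forall n m (X : mxfam R g n) (Y : mxfam R g m) G,
  U X -> U Y -> intertwines (f X) (f Y) G -> intertwines X Y G.
Hypothesis circU : forall n (X : mxfam R g n) c, normc c = 1 -> U X -> U (scalef c X).
Hypothesis circf : forall n (X : mxfam R g n) c, normc c = 1 -> U X ->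
  exists2 Y : mxfam R g n, U Y & forall j, f Y j = c *: f X j.
Hypothesis open0 : forall n, exists2 d : R, 0 < d & forall X : mxfam R g n, cube d X -> U X.
Hypothesis f0 : forall n j, f (fun=> 0 : 'M[R[i]]_n) j = 0.

Let U0 n : U (fun=> 0 : 'M[R[i]]_n).
Proof. by have [d d0 dU] := open0 n; apply: dU; exact: cube0. Qed.

Let f_inj n (X Y : mxfam R g n) : U X -> U Y -> (forall j, f X j = f Y j) -> X = Y.
Proof.
move=> UX UY XY; apply/funext => j; rewrite -[LHS]mulmx1 -[RHS]mul1mx.
by apply: intertwines_f => // i; rewrite mulmx1 mul1mx.
Qed.

Lemma scalef_shift n m (K : 'I_g -> 'M[R[i]]_(n, m)) c :
  scalef c (upper_block (fun=> 0) K (fun=> 0)) =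
  upper_block (fun=> 0) (fun j => c *: K j) (fun=> 0).
Proof. by apply/funext => j; rewrite /scalef /upper_block scale_block_mx !scaler0. Qed.

(* [G X = f^-1 (c^-1 f (c X))]; it is a free map because [f] reflects intertwinings. *)
Lemma rotation_commutator (c : R[i]) n d : 0 < d -> normc c = 1 ->
  (forall X : mxfam R g (n + n), cube d X -> U X) ->
  exists2 G, shift_fixing (@U) n d G &
    forall m (X : mxfam R g m), U X -> forall j, f (G m X) j = c^-1 *: f (scalef c X) j.
Proof.
move=> d0 c1 U2.
(* Circularity of [U] keeps [c X] in [U], and circularity of the range makes [c^-1 f (c X)] a value
   of [f]. Outside [U] the witness is an arbitrary default. *)
have H m (X : mxfam R g m) : exists Y, U X ->
    U Y /\ forall j, f Y j = c^-1 *: f (scalef c X) j.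
  have [UX|nUX] := pselect (U X); last by exists X.
  have cV : normc c^-1 = 1 by rewrite normcV c1 invr1.
  by have [Y UY YE] := circf cV (circU c1 UX); exists Y.
pose G m (X : mxfam R g m) := projT1 (cid (H m X)).
have GU m (X : mxfam R g m) : U X -> U (G m X).
  by move=> UX; rewrite /G; case: (cid _) => Y /= /(_ UX) [].
have GE m (X : mxfam R g m) : U X -> forall j, f (G m X) j = c^-1 *: f (scalef c X) j.
  by move=> UX; rewrite /G; case: (cid _) => Y /= /(_ UX) [].
have c0 : c != 0 by rewrite -normc_gt0 c1.
exists G => //; split => //.
- move=> m p X Y B UX UY XY; apply: intertwines_f; try exact: GU.
  move=> j; rewrite !GE // -scalemxAl -scalemxAr; congr (_ *: _).
  apply: free_f; try exact: circU.
  by move=> i; rewrite /scalef -scalemxAl -scalemxAr XY.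
- apply: f_inj => [||j]; [exact: GU|exact: U0|rewrite GE //].
  rewrite f0 -[RHS](scaler0 _ c^-1); congr (_ *: _).
  have -> : scalef c (fun _ : 'I_g => 0 : 'M[R[i]]_n) = (fun=> 0).
    by apply/funext => i; rewrite /scalef scaler0.
  exact: f0.
- move=> K cK.
  have UK : U (upper_block (fun=> 0) K (fun=> 0)).
    by apply: U2; apply: cube_upper_block => //; exact: cube0.
  apply: f_inj => [||j]; [exact: GU|exact: UK|rewrite GE // scalef_shift].
  rewrite (free_shift_homogeneous free_f) // ?scalerA ?mulVf ?scale1r //.
  by rewrite -scalef_shift; exact: circU.
Qed.

(** The commutator of [f] with the rotation is the identity near [0] by [shift_fixing_id]. The
    radius is chosen before [c], as the estimates are uniform in the self-map. *)
Lemma rotation_near0 n : exists2 r : R, 0 < r &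
  forall X : mxfam R g n, cube r X -> forall c, normc c = 1 ->
  forall j, f (scalef c X) j = c *: f X j.
Proof.
have [d1 d10 U1] := open0 n; have [d2 d20 U2] := open0 (n + n).
have [d4 d40 U4] := open0 ((n + n) + (n + n)).
pose d := Num.min d1 (Num.min d2 d4).
have d0 : 0 < d by rewrite !lt_min d10 d20.
have [l1 l2 l4] : [/\ d <= d1, d <= d2 & d <= d4] by rewrite !ge_min !lexx !orbT.
have M1 : 0 < M + 1 by rewrite ltr_wpDl.
(* The denominator has [M + 1] because [M] may be [0]. *)
pose r := Num.min d (d ^+ 2 / (8 * (M + 1))).
have r0 : 0 < r by rewrite lt_min d0 divr_gt0 ?exprn_gt0 // mulr_gt0.
have rd : r <= d by rewrite ge_min lexx.
have rM : 8 * M * r <= d ^+ 2.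
  have : r <= d ^+ 2 / (8 * (M + 1)) by rewrite ge_min lexx orbT.
  rewrite ler_pdivlMr ?mulr_gt0 // => h; apply: le_trans h.
  by rewrite mulrC ler_wpM2l ?(ltW r0) // ler_pM2l // lerDl.
exists (r / 2); first by rewrite divr_gt0.
move=> X cX c c1 j.
have {}U1 (Y : mxfam R g n) : cube d Y -> U Y by move=> h; apply: U1; exact: cube_le h.
have {}U2 (Y : mxfam R g (n + n)) : cube d Y -> U Y by move=> h; apply: U2; exact: cube_le h.
have {}U4 (Y : mxfam R g ((n + n) + (n + n))) : cube d Y -> U Y.
  by move=> h; apply: U4; exact: cube_le h.
have [G sG GE] := rotation_commutator d0 c1 U2.
have GX := shift_fixing_id M0 bdU r0 rd rM U1 U2 U4 sG cX.
have UX : U X.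
  by apply: U1; apply: cube_le cX; rewrite (le_trans _ rd) // ler_pdivrMr // ler_peMr ?(ltW r0) // ler1n.
have c0 : c != 0 by rewrite -normc_gt0 c1.
by have := GE n X UX j; rewrite GX => ->; rewrite scalerA mulfV // scale1r.
Qed.

(** For [t != 0] this is [t^-1 f (t X)] by [free_corner]; the block form extends it to [t = 0]. *)
Let corner n (X : mxfam R g n) (t : R[i]) (j : 'I_gt) : 'M[R[i]]_n :=
  ursubmx (f (upper_block (scalef t X) X (fun=> 0)) j).

(** [diag(1, c)] intertwines [[[c t X, X], [0, 0]]] with [c [[t X, X], [0, 0]]], and [f] commutes
    with the rotation of the latter. *)
Lemma corner_rotation n : exists2 r : R, 0 < r &
  forall X : mxfam R g n, cube r X -> forall t c, normc t <= 1 -> normc c = 1 ->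
  forall j, corner X (c * t) j = corner X t j.
Proof.
have [r r0 rot] := rotation_near0 (n + n).
have [d1 d10 U1] := open0 n; have [d2 d20 U2] := open0 (n + n).
pose d := Num.min r (Num.min d1 d2).
have d0 : 0 < d by rewrite !lt_min r0 d10.
have [l0 l1 l2] : [/\ d <= r, d <= d1 & d <= d2] by rewrite !ge_min !lexx !orbT.
exists d; [exact: d0|move=> X cX t c t1 c1 j].
have scX s : normc s <= 1 -> cube d (scalef s X).
  move=> s1 i a b; rewrite !mxE normcM; apply: le_lt_trans (cX i a b).
  by rewrite ler_piMl ?normc_ge0.
have cZ s : normc s <= 1 -> cube d (upper_block (scalef s X) X (fun=> 0) : mxfam R g (n + n)).
  by move=> s1; apply: cube_upper_block => //; [exact: scX|exact: cube0].
have ct1 : normc (c * t) <= 1 by rewrite normcM c1 mul1r.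
have UZ s : normc s <= 1 -> U (upper_block (scalef s X) X (fun=> 0) : mxfam R g (n + n)).
  by move=> s1; apply: U2; apply: cube_le (cZ s s1).
have UX s : normc s <= 1 -> U (scalef s X).
  by move=> s1; apply: U1; apply: cube_le (scX s s1).
set Z := upper_block (scalef t X) X (fun=> 0) : mxfam R g (n + n).
set W := upper_block (scalef (c * t) X) X (fun=> 0) : mxfam R g (n + n).
have : f W j *m block_mx 1%:M 0 0 c%:M = block_mx 1%:M 0 0 c%:M *m f (scalef c Z) j.
  apply: free_f; [exact: UZ|by apply: circU => //; exact: UZ|].
  move=> i; rewrite /scalef /W /Z /upper_block scale_block_mx !mulmx_block.
  rewrite !scaler0 !mulmx0 !mul0mx !mulmx1 !mul1mx !addr0 !add0r.
  by rewrite mul_mx_scalar scalerA.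
rewrite (rot _ (cube_le l0 (cZ t t1)) c c1).
have shape s : normc s <= 1 -> f (upper_block (scalef s X) X (fun=> 0)) j =
    block_mx (f (scalef s X) j) (corner X s j) 0 0.
  by move=> s1; rewrite {1}(free_upper_block free_f) ?f0 //; [exact: UZ|exact: UX].
rewrite [f W j](shape _ ct1) [f Z j](shape _ t1) scale_block_mx !mulmx_block.
rewrite !scaler0 !mulmx0 !mul0mx !mulmx1 !mul1mx !addr0 !add0r.
move=> /eq_block_mx [_ + _ _]; rewrite mul_mx_scalar.
by apply: scalerI; rewrite -normc_gt0 c1.
Qed.

(** [free_taylor] gives [corner (t + w) = A + w B + w^2 C] with [C] bounded by [M]. For
    [w = (c - 1) t] with [|c| = 1] the corner does not change, so [B = - w C]; letting [c] tend to
    [1] yields [B = 0]. Here [t != 0] keeps [w] nonzero. *)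
Lemma corner_taylor n : exists2 r : R, 0 < r &
  forall X : mxfam R g n, cube r X -> forall t w : R[i],
  normc t <= 1 -> t != 0 -> normc (t + w) <= 1 -> forall j a b,
  normc (corner X (t + w) j a b - corner X t j a b) <= M * normc w ^+ 2.
Proof.
have [r r0 rot] := corner_rotation n.
have [d2 d20 U2] := open0 (n + n).
have [d4 d40 U4] := open0 ((n + n) + (n + n)).
have [d6 d60 U6] := open0 ((n + n) + ((n + n) + (n + n))).
pose d := Num.min (Num.min r d2) (Num.min d4 d6).
have d0 : 0 < d by rewrite !lt_min r0 d20 d40.
have [lr l2 l4 l6] : [/\ d <= r, d <= d2, d <= d4 & d <= d6].
  by rewrite !ge_min !lexx !orbT.
exists d; [exact: d0|move=> X cX t w t1 t0 tw1 j a b].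
pose P : mxfam R g (n + n) := upper_block (scalef t X) X (fun=> 0).
pose D : mxfam R g (n + n) := upper_block X (fun=> 0) (fun=> 0).
have PD s : (fun i => P i + s *: D i) = upper_block (scalef (t + s) X) X (fun=> 0).
  apply/funext => i; rewrite /P /D /upper_block scale_block_mx add_block_mx.
  by rewrite /scalef !scaler0 !addr0 scalerDl.
have scX s : normc s <= 1 -> cube d (scalef s X).
  move=> s1 i a' b'; rewrite !mxE normcM; apply: le_lt_trans (cX i a' b').
  by rewrite ler_piMl ?normc_ge0.
have cZ s : normc s <= 1 -> cube d (upper_block (scalef s X) X (fun=> 0) : mxfam R g (n + n)).
  by move=> s1; apply: cube_upper_block => //; [exact: scX|exact: cube0].
have cD : cube d D by apply: cube_upper_block => //; exact: cube0.
have cP : cube d P by exact: cZ.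
pose A := ulsubmx (f (upper_block P D P) j); pose B := ursubmx (f (upper_block P D P) j).
have main s : normc (t + s) <= 1 -> exists C : 'M[R[i]]_n,
    (forall a b, normc (C a b) <= M) /\
    corner X (t + s) j = ursubmx A + s *: ursubmx B + s ^+ 2 *: C.
  move=> ts.
  have cPs : cube d (fun i => P i + s *: D i) by rewrite PD; exact: cZ.
  pose T := upper_block P (fun i => row_mx (D i) 0)
                 (upper_block P D (fun i => P i + s *: D i)).
  have UT : U T.
    apply: U6; apply: (cube_le l6); apply: cube_upper_block => //.
      move=> i; apply: (@row_mx_ind _ (fun z => normc z < d)); first exact: cD.
      by move=> *; rewrite mxE normc0.
    exact: cube_upper_block.
  have := free_taylor free_f UT (U2 _ (cube_le l2 cPs)) (U4 _ (cube_le l4 (cube_upper_block d0 cP cD cP))) j.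
  rewrite -/A -/B -/T => E.
  exists (ursubmx (rsubmx (ursubmx (f T j)))); split.
    by move=> a' b'; rewrite !mxE; exact: bdf.
  by rewrite /corner -PD E; apply/matrixP => a' b'; rewrite !mxE.
have AE : corner X t j = ursubmx A.
  have [|C [_]] := main 0; first by rewrite addr0.
  by rewrite addr0 scale0r expr0n scale0r !addr0.
have B0 : ursubmx B = 0.
  apply/matrixP => a' b'; rewrite [RHS]mxE; apply/eq0_normc/eqP.
  rewrite eq_le normc_ge0 andbT; apply/ler_addgt0Pr => e e0; rewrite add0r.
  have M1 : 0 < M + 1 by rewrite ltr_wpDl.
  have [c [c1 cn1 ce]] := unit_complex_near1 (divr_gt0 e0 M1).
  have tc : t + (c - 1) * t = c * t by ring.
  have [|C [CM]] := main ((c - 1) * t); first by rewrite tc normcM c1 mul1r.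
  rewrite tc rot //; last exact: cube_le cX.
  rewrite AE -addrA -[X in X = _]addr0 => /addrI/matrixP /(_ a' b') E.
  rewrite !mxE in E.
  have s0 : (c - 1) * t != 0 by rewrite mulf_neq0 // subr_eq0.
  have {E} E : ursubmx B a' b' = - ((c - 1) * t) * C a' b'.
    rewrite !mxE; apply: (mulfI s0); apply/eqP; rewrite -subr_eq0; apply/eqP.
    by rewrite [RHS]E; ring.
  rewrite E normcM normcN normcM.
  have h1 := CM a' b'; have h0 := normc_ge0 (C a' b').
  apply: (@le_trans _ _ (e / (M + 1) * M)).
    apply: ler_pM; rewrite ?mulr_ge0 ?normc_ge0 //.
    by apply: le_trans ce; rewrite ler_piMr ?normc_ge0.
  rewrite mulrAC ler_pdivrMr // ler_pM2l // lerDl //.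
have [C [CM ->]] := main w tw1.
rewrite AE B0 scaler0 addr0 [_ a b]mxE addrAC subrr add0r mxE normcM normcX mulrC.
by rewrite ler_wpM2r ?sqr_ge0 ?exprn_ge0 ?normc_ge0.
Qed.

(** Cutting [[0, 1]] into [N] pieces, each increment is at most [M / N^2], so the total is at most
    [M / N]. *)
Lemma corner_cst n : exists2 r : R, 0 < r &
  forall X : mxfam R g n, cube r X -> forall j, corner X 1 j = corner X 0 j.
Proof.
have [r r0 ct] := corner_taylor n; exists r; [exact: r0|move=> X cX j].
apply/matrixP => a b; apply/eqP; rewrite -subr_eq0; apply/eqP/eq0_normc/eqP.
rewrite eq_le normc_ge0 andbT; apply: (@le_eps_natP _ _ _ M) => //.
case=> [|m]; first by rewrite !mul0r addr0.
rewrite mulr0 addr0; set N : R := m.+1%:R.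
have N0 : 0 < N by rewrite ltr0n.
have nr (x : R) : 0 <= x -> normc x%:C = x by move=> x0; rewrite normc_real ger0_norm.
have tri (p q : R) (x y z : R[i]) :
    normc (y - x) <= p -> normc (y - z) <= q -> normc (x - z) <= p + q.
  rewrite normcB => h1 h2; have := le_normcD (x - y) (y - z); rewrite addrA subrK.
  by move=> h; apply: le_trans h _; exact: lerD.
have step k : (k <= m.+1)%N ->
    normc (corner X (k%:R / N)%:C j a b - corner X 0 j a b) <= k%:R * (M / N ^+ 2).
  elim: k => [|k IH] km; first by rewrite !mul0r subrr normc0.
  have kN : (k.+1%:R / N : R) <= 1 by rewrite ler_pdivrMr // mul1r ler_nat.
  have kN' : (k%:R / N : R) <= 1 by rewrite ler_pdivrMr // mul1r ler_nat ltnW.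
  have kw : (k.+1%:R / N)%:C + (- N^-1)%:C = (k%:R / N)%:C :> R[i].
    by rewrite -rmorphD /= -natr1 mulrDl mul1r addrK.
  (* Each piece is expanded at its right endpoint, which is never the excluded point [t = 0]. *)
  have := @ct X cX (k.+1%:R / N)%:C (- N^-1)%:C _ _ _ j a b.
  rewrite kw (nr (k.+1%:R / N)) ?(nr (k%:R / N)) ?divr_ge0 ?ler0n ?(ltW N0) // => /(_ kN _ kN').
  rewrite normc_real normrN gtr0_norm ?invr_gt0 // => H.
  have {}H := H ltac:(by rewrite (inj_eq (@complexI R)) gt_eqF // divr_gt0 // ltr0n).
  have -> : k.+1%:R * (M / N ^+ 2) = M * N^-1 ^+ 2 + k%:R * (M / N ^+ 2).
    by rewrite exprVn -natr1 mulrDl mul1r addrC.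
  exact: tri H (IH (ltnW km)).
have := step m.+1 (leqnn _); rewrite -/N mulfV ?gt_eqF //.
have -> : N * (M / N ^+ 2) = M / N by field; rewrite gt_eqF.
by rewrite ler_pdivlMr // mulrC.
Qed.

(** The corner at [t = 1] is [f X] by [free_corner], and at [t = 0] it is the corner of the value at
    a shift, which is homogeneous in [X]. *)
Lemma homogeneous_near0 n : exists2 r : R, 0 < r &
  forall X : mxfam R g n, cube r X -> forall t, normc t <= 1 ->
  forall j, f (scalef t X) j = t *: f X j.
Proof.
have [r r0 cc] := corner_cst n.
have [d1 d10 U1] := open0 n; have [d2 d20 U2] := open0 (n + n).
pose d := Num.min r (Num.min d1 d2).
have d0 : 0 < d by rewrite !lt_min r0 d10.
have [l0 l1 l2] : [/\ d <= r, d <= d1 & d <= d2] by rewrite !ge_min !lexx !orbT.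
exists d; [exact: d0|move=> X cX t t1 j].
have US (Y : mxfam R g n) : cube d Y -> U (upper_block (fun=> 0) Y (fun=> 0)).
  move=> cY; apply: U2; apply: (cube_le l2).
  by apply: cube_upper_block => //; exact: cube0.
have key (Y : mxfam R g n) : cube d Y ->
    f Y j = ursubmx (f (upper_block (fun=> 0) Y (fun=> 0)) j).
  move=> cY; have UY : U Y by apply: U1; exact: cube_le cY.
  have := cc Y (cube_le l0 cY) j; rewrite /corner.
  have -> : scalef 0 Y = (fun=> 0) by apply/funext => i; rewrite /scalef scale0r.
  move=> <-.
  have E : upper_block (scalef 1 Y) Y (fun=> 0) =
      upper_block Y (fun i => 1 *: (Y i - 0)) (fun=> 0).
    by apply/funext => i; rewrite /upper_block /scalef !scale1r subr0.
  rewrite E (free_corner free_f) //; first by rewrite scale1r f0 subr0.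
  rewrite -E; apply: U2; apply: (cube_le l2).
  apply: cube_upper_block => //; last exact: cube0.
  by move=> i a b; rewrite /scalef scale1r.
have ctX : cube d (scalef t X).
  move=> i a b; rewrite !mxE normcM; apply: le_lt_trans (cX i a b).
  by rewrite ler_piMl ?normc_ge0.
rewrite (key _ ctX) (key _ cX) (free_shift_homogeneous free_f) //; try exact: US.
by apply/matrixP => a b; rewrite !mxE.
Qed.

End CircularFreeMaps.

Lemma exists_cube (R : realType) k n m (H : 'I_k -> 'M[R[i]]_(n, m)) :
  exists2 d : R, 0 < d & cube d H.
Proof.
exists (1 + \sum_j \sum_a \sum_b normc (H j a b)).
  apply: ltr_wpDr; last exact: ltr01.
  by do ?(apply: sumr_ge0 => ? _); exact: normc_ge0.
move=> j a b; apply: (@le_lt_trans _ _ (\sum_j \sum_a \sum_b normc (H j a b))).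
  rewrite (bigD1 j) //= (bigD1 a) //= (bigD1 b) //= -!addrA lerDl.
  apply: addr_ge0; [|apply: addr_ge0]; do ?(apply: sumr_ge0 => ? _); exact: normc_ge0.
by rewrite ltrDr ltr01.
Qed.

Lemma upper_block_sub (R : realType) k n m (X X' : mxfam R k n) H H' (Y Y' : mxfam R k m) :
  (fun j => upper_block X H Y j - upper_block X' H' Y' j) =
  upper_block (fun j => X j - X' j) (fun j => H j - H' j) (fun j => Y j - Y' j).
Proof.
by apply/funext => j; rewrite /upper_block opp_block_mx add_block_mx subrr.
Qed.

Lemma corner13B (V : zmodType) n (Z Z' : 'M[V]_(n + (n + n))) a b :
  rsubmx (ursubmx Z) a b - rsubmx (ursubmx Z') a b =
  (Z - Z') (lshift (n + n) a) (rshift n (rshift n b)).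
Proof. by rewrite !mxE. Qed.

(** * Second-order expansion of a free map along complex lines *)

Section LineTaylor.
Variables (R : realType) (g gt : nat) (U : forall n, mxfam R g n -> Prop).
Variable f : forall n, mxfam R g n -> mxfam R gt n.
Arguments U {n}.
Arguments f {n}.
Hypothesis free_f : free_on (@U) (@f).
Hypothesis dsumU : forall n m (X : mxfam R g n) (Y : mxfam R g m),
  U X -> U Y -> U (upper_block X (fun=> 0) Y).
Hypothesis openU : forall n (X : mxfam R g n), U X -> exists2 d : R, 0 < d &
  forall Y : mxfam R g n, cube d (fun j => Y j - X j) -> U Y.
Hypothesis contf : forall n (X : mxfam R g n), U X -> forall e : R, 0 < e ->
  exists2 d : R, 0 < d & forall Y : mxfam R g n,
    cube d (fun j => Y j - X j) -> cube e (fun j => f Y j - f X j).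

(** [free_taylor] applies once the direction is rescaled so that the block tuples stay near [P],
    [P (+) P] and [P (+) P (+) P], which lie in [U]. The remainder is an entry of [f] at a tuple
    depending continuously on the parameter. *)
Lemma line_taylor2 n (X H : mxfam R g n) (z : R[i]) j a b :
  U (fun i => X i + z *: H i) ->
  taylor2 (fun u => f (fun i => X i + u *: H i) j a b) z.
Proof.
set P : mxfam R g n := fun i => _ => UP.
have UP2 := dsumU UP UP; have UP3 := dsumU UP UP2.
have [d1 d10 o1] := openU UP; have [d2 d20 o2] := openU UP2.
have [d3 d30 o3] := openU UP3; have [K K0 cK] := exists_cube H.
pose d := Num.min d1 (Num.min d2 d3).
have d0 : 0 < d by rewrite !lt_min d10 d20.
have [l1 l2 l3] : [/\ d <= d1, d <= d2 & d <= d3] by rewrite !ge_min !lexx !orbT.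
pose tau := d / K; have t0 : 0 < tau by rewrite divr_gt0.
have tC0 : tau%:C != 0 :> R[i] by rewrite (inj_eq (@complexI R)) gt_eqF.
pose Ht : mxfam R g n := fun i => tau%:C *: H i.
have cHt : cube d Ht.
  move=> i a' b'; rewrite mxE normcM normc_real gtr0_norm //.
  by have := cK i a' b'; rewrite -(ltr_pM2l t0) /tau divfK ?gt_eqF.
have cwHt w : normc w <= 1 -> cube d (fun i => w *: Ht i).
  move=> w1 i a' b'; rewrite mxE normcM; apply: le_lt_trans (cHt i a' b').
  by rewrite ler_piMl ?normc_ge0.
pose Pw w : mxfam R g n := fun i => P i + w *: Ht i.
pose T w := upper_block P (fun i => row_mx (Ht i) 0) (upper_block P Ht (Pw w)).
have PwP w : (fun i => Pw w i - P i) = fun i => w *: Ht i.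
  by apply/funext => i; rewrite /Pw addrAC subrr add0r.
have c0 m p : cube d (fun _ : 'I_g => 0 - 0 : 'M[R[i]]_(m, p)).
  by move=> i a' b'; rewrite subrr mxE normc0.
have cX m (Y : mxfam R g m) : cube d (fun i => Y i - Y i).
  by move=> i a' b'; rewrite subrr mxE normc0.
have cH0 m p (Y : 'I_g -> 'M[R[i]]_(m, p)) : cube d Y -> cube d (fun i => Y i - 0).
  by move=> cY i a' b'; rewrite subr0.
have UPw w : normc w <= 1 -> U (Pw w).
  by move=> w1; apply: o1; apply: (cube_le l1); rewrite PwP; exact: cwHt.
have UP2' : U (upper_block P Ht P).
  by apply: o2; apply: (cube_le l2); rewrite upper_block_sub; apply: cube_upper_block => //; exact: cH0.
have UT w : normc w <= 1 -> U (T w).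
  move=> w1; apply: o3; apply: (cube_le l3); rewrite upper_block_sub.
  apply: cube_upper_block => //.
    apply: cH0 => i; apply: (@row_mx_ind _ (fun z => normc z < d)); first exact: cHt.
    by move=> *; rewrite mxE normc0.
  rewrite upper_block_sub; apply: cube_upper_block => //; first exact: cH0.
  by rewrite PwP; exact: cwHt.
pose A := ulsubmx (f (upper_block P Ht P) j) a b.
pose B := ursubmx (f (upper_block P Ht P) j) a b.
pose C w := rsubmx (ursubmx (f (T w) j)) a b.
have main w : normc w <= 1 -> f (Pw w) j a b = A + w * B + w ^+ 2 * C w.
  move=> w1; have := free_taylor free_f (UT w w1) (UPw w w1) UP2' j.
  rewrite -/(T w) => ->.
  by rewrite [LHS]mxE [X in X + _ = _]mxE [X in _ + X + _ = _]mxE [X in _ + X = _]mxE.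
have PwE u : (fun i => X i + (z + u) *: H i) = Pw (u / tau%:C).
  by apply/funext => i; rewrite /Pw /Ht /P scalerDl addrA scalerA divfK.
have nu u : normc (u / tau%:C) = normc u / tau.
  by rewrite normcM normcV normc_real gtr0_norm.
have P0 : f P j a b = A.
  rewrite -[RHS]addr0 -[X in _ = _ + X](mul0r B) -[RHS]addr0.
  rewrite -[X in _ = _ + X](mul0r (C 0)) -[X in X * C 0](expr0n _ 2) -main ?normc0 //.
  by congr (f _ j a b); apply/funext => i; rewrite /Pw scale0r addr0.
(* Passing from the direction [tau H] back to [H] substitutes [u / tau] for the parameter. *)
exists (B / tau%:C), (fun u => tau%:C ^- 2 * C (u / tau%:C)); split.
  apply: continuous_at0M; first exact: continuous_at0_cst.
  move=> e e0.
  have T0 : U (T 0) by apply: UT; rewrite normc0.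
  have [d' d'0 cont] := contf T0 e0.
  exists (tau * Num.min 1 (d' / d)).
    by rewrite mulr_gt0 // lt_min ltr01 divr_gt0.
  move=> w; rewrite mulrC -ltr_pdivrMr // -nu mul0r lt_min => /andP [w1 w2].
  have cT : cube d' (fun i => T (w / tau%:C) i - T 0 i).
    rewrite upper_block_sub; apply: cube_upper_block => //.
    - by move=> i a' b'; rewrite subrr mxE normc0.
    - by move=> i a' b'; rewrite subrr mxE normc0.
    rewrite upper_block_sub; apply: cube_upper_block => //.
    - by move=> i a' b'; rewrite subrr mxE normc0.
    - by move=> i a' b'; rewrite subrr mxE normc0.
    move=> i a' b'; rewrite /Pw scale0r addr0 addrAC subrr add0r mxE normcM.
    move: w2; rewrite ltr_pdivlMr // => w2; apply: le_lt_trans w2.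
    by rewrite ler_wpM2l ?normc_ge0 // ltW.
  have H13 := corner13B (f (T (w / tau%:C)) j) (f (T 0) j) a b.
  have ltE := cont _ cT j (lshift (n + n) a) (rshift n (rshift n b)).
  exact: (eq_ind_r (fun z => normc z < e) ltE H13).
exists tau => // u ut; rewrite PwE main; last by rewrite nu ler_pdivrMr // mul1r ltW.
rewrite -/P P0; field; exact: tC0.
Qed.

End LineTaylor.

(** * Proper free maps between noncommutative domains *)

Section TupleEncoding.
Variables (R : realType) (g : nat).

Lemma tcomp_tmk n (X : mxfam R g n) j : tcomp (tmk X) j = X j.
Proof. by apply/matrixP => a b; rewrite !mxE mxvecE mxE. Qed.

Lemma tcompK n (X : mxfam R g n) : tcomp (tmk X) = X.
Proof. by apply/funext => j; exact: tcomp_tmk. Qed.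

Lemma tmk_tcomp n (X : 'M[R[i]]_(n, g * n)) : tmk (tcomp X) = X.
Proof.
by apply/matrixP => a k; rewrite mxE; case/mxvec_indexP: k => j b; rewrite mxvecE !mxE.
Qed.

Lemma tmkE n (X : mxfam R g n) a j b : tmk X a (mxvec_index j b) = X j a b.
Proof. by rewrite -[in RHS](tcomp_tmk X j) [RHS]mxE. Qed.

Lemma tmkZ n c (X : mxfam R g n) : tmk (scalef c X) = c *: tmk X.
Proof.
by apply/matrixP => a k; case/mxvec_indexP: k => j b; rewrite [RHS]mxE !tmkE mxE.
Qed.

Lemma tmkD n (X Y : mxfam R g n) : tmk (fun j => X j + Y j) = tmk X + tmk Y.
Proof.
by apply/matrixP => a k; case/mxvec_indexP: k => j b; rewrite [RHS]mxE !tmkE mxE.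
Qed.

Lemma tmk0 n : tmk (fun=> 0 : 'M[R[i]]_n) = 0 :> 'M[R[i]]_(n, g * n).
Proof. by apply/matrixP => a k; case/mxvec_indexP: k => j b; rewrite tmkE !mxE. Qed.

Lemma tcompZ n c (X : 'M[R[i]]_(n, g * n)) j : tcomp (c *: X) j = c *: tcomp X j.
Proof. by apply/matrixP => a b; rewrite !mxE. Qed.

Lemma tcompD n (X Y : 'M[R[i]]_(n, g * n)) j : tcomp (X + Y) j = tcomp X j + tcomp Y j.
Proof. by apply/matrixP => a b; rewrite !mxE. Qed.

Lemma tcomp0 n j : tcomp (0 : 'M[R[i]]_(n, g * n)) j = 0.
Proof. by apply/matrixP => a b; rewrite !mxE. Qed.

Lemma tcomp_inj n (X Y : 'M[R[i]]_(n, g * n)) : (forall j, tcomp X j = tcomp Y j) -> X = Y.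
Proof.
by move=> XY; rewrite -(tmk_tcomp X) -(tmk_tcomp Y); congr tmk; apply/funext.
Qed.

Lemma nbhs_cube n (X : tupN R g n) (A : set (tupN R g n)) : nbhs X A ->
  exists2 d : R, 0 < d & forall Y : tupN R g n,
    cube d (fun j => tcomp Y j - tcomp X j) -> A Y.
Proof.
(* Radii are complex numbers here; positivity forces the imaginary part to be [0]. *)
move=> /nbhs_ballP [[d ?]]; rewrite /= ltcE /= => /andP [/eqP -> d0] dA.
exists d => // Y cY; apply: dA; split; first by rewrite ltcE /= eqxx.
move=> a k; case/mxvec_indexP: k => j b.
rewrite /ball /= [ltLHS]normCE ltcR normcB.
by have := cY j a b; rewrite !mxE.
Qed.

Lemma open_cube n (O : set (tupN R g n)) (X : mxfam R g n) : open O -> O (tmk X) ->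
  exists2 d : R, 0 < d & forall Y : mxfam R g n, cube d (fun j => Y j - X j) -> O (tmk Y).
Proof.
move=> oO OX; have [d d0 dO] := nbhs_cube (open_nbhs_nbhs (conj oO OX)).
exists d; [exact: d0|move=> Y cY; apply: dO].
by rewrite (tcompK Y) (tcompK X).
Qed.

Lemma cube_nbhs n (X : tupN R g n) (d : R) : 0 < d ->
  nbhs X [set Y : tupN R g n | cube d (fun j => tcomp Y j - tcomp X j)].
Proof.
move=> d0; apply/nbhs_ballP; exists d%:C; rewrite /= ?ltcR // => Y [_ XY] j a b.
rewrite !mxE; have := XY a (mxvec_index j b).
by rewrite /ball /= [ltLHS]normCE ltcR normcB.
Qed.

Lemma open_line n m (X : mxfam R g n) K (Y : mxfam R g m) (O : set (tupN R g (n + m))) :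
  open O -> open [set t : R | O (tmk (upper_block X (fun j => t%:C *: K j) Y))].
Proof.
move=> oO; rewrite openE => t /= Ot; have [kap kap0 ck] := exists_cube K.
have [d d0 dO] := open_cube oO Ot.
apply/nbhs_ballP; exists (d / kap); first exact: divr_gt0.
move=> s; rewrite /ball /= => ts; apply: dO.
rewrite upper_block_sub; apply: cube_upper_block => //.
- by move=> *; rewrite subrr mxE normc0.
- move=> i a' b'; rewrite -scalerBl mxE normcM -rmorphB normc_real distrC.
  move: ts; rewrite ltr_pdivlMr // => ts; apply: le_lt_trans ts.
  by rewrite ler_wpM2l ?normr_ge0 // ltW.
- by move=> *; rewrite subrr mxE normc0.
Qed.

End TupleEncoding.

(** Testing positive definiteness on the basis vector [e_a] bounds the sum of [|X_j a l|^2] over [j]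
    and [l] by [c^2]. *)
Lemma nc_bounded_entries (R : realType) g (U : ncset R g) : nc_bounded U ->
  exists2 M : R, 0 <= M & forall n (X : 'M[R[i]]_(n, g * n)), U n X ->
    forall j a b, normc (tcomp X j a b) <= M.
Proof.
move=> [c Uc]; exists `|c|; first exact: normr_ge0.
move=> n X /Uc [_ pos] j a b.
pose v : 'cV[R[i]]_n := delta_mx a 0.
have v0 : v != 0.
  by apply/eqP => /matrixP /(_ a 0); rewrite !mxE !eqxx => /eqP; rewrite oner_eq0.
have := pos v v0.
have -> : adjmx v = delta_mx 0 a.
  by apply/matrixP => x y; rewrite !mxE andbC; case: (_ && _); rewrite ?conjc1 ?conjc0.
rewrite -rowE -colE !mxE summxE eqxx mulr1n.
have -> : \sum_k (tcomp X k *m adjmx (tcomp X k)) a a =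
    (\sum_k \sum_l normc (tcomp X k a l) ^+ 2)%:C.
  rewrite rmorph_sum; apply: eq_bigr => k _; rewrite mxE rmorph_sum.
  apply: eq_bigr => l _; rewrite [adjmx _ _ _]mxE [map_mx _ _ _ _]mxE.
  by rewrite -sqr_normc normCE -rmorphXn.
rewrite -rmorphXn -rmorphB ltcR subr_gt0 => lt.
rewrite -(@ler_pXn2r _ 2) ?nnegrE ?normc_ge0 ?normr_ge0 // real_normK ?num_real //.
apply: le_trans (ltW lt).
have <- : tcomp X j a b = X a (mxvec_index j b) by rewrite mxE.
move: (tcomp X) => Y; rewrite (bigD1 j) //= (bigD1 b) //= -addrA lerDl.
by apply: addr_ge0; do ?(apply: sumr_ge0 => ? _); exact: sqr_ge0.
Qed.

(** Links the condition [|c| = 1] to the [e^{it}] of [nc_circular]; the sign of the imaginary part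
    decides between [acos x] and its opposite. *)
Lemma unit_complex_trigo (R : realType) (c : R[i]) : normc c = 1 ->
  exists t : R, c = cos t +i* sin t.
Proof.
case: c => x y c1; have xy : x ^+ 2 + y ^+ 2 = 1 by have := sqr_normcE (x +i* y); rewrite c1 /=; lra.
have x1 : -1 <= x <= 1.
  by rewrite -ler_norml -(@ler_pXn2r _ 2) ?nnegrE // real_normK ?num_real //; have := sqr_ge0 y; lra.
have yE : 1 - x ^+ 2 = y ^+ 2 by lra.
have [y0|y0] := leP 0 y.
  exists (acos x); rewrite acosK // sin_acos // yE sqrtr_sqr ger0_norm //.
exists (- acos x); rewrite cosN sinN acosK // sin_acos // yE sqrtr_sqr.
by rewrite ltr0_norm // opprK.
Qed.

Lemma mulmx_cancelr (F : comNzRingType) m n (A B : 'M[F]_(m, n)) (S T : 'M[F]_n) :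
  S *m T = 1%:M -> A *m S = B *m S -> A = B.
Proof. by move=> ST AB; rewrite -[A]mulmx1 -[B]mulmx1 -ST !mulmxA AB. Qed.

Section NoncommutativeDomains.
Variables (R : realType) (g gt : nat) (U : ncset R g) (V : ncset R gt).
Variable f : ncfun R g gt.
Arguments U : clear implicits.
Arguments V : clear implicits.
Arguments f : clear implicits.

Definition famset n (X : mxfam R g n) : Prop := U n (tmk X).
Definition fammap n (X : mxfam R g n) : mxfam R gt n := tcomp (f n (tmk X)).
Arguments famset {n}.
Arguments fammap {n}.

Hypothesis openU : forall n, @open (tupN R g n) (U n).
Hypothesis closedU : nc_closed U.
Hypothesis bdU : nc_bounded U.
Hypothesis fUV : maps_into U V f.
Hypothesis freef : free_map U f.
Hypothesis properf : nc_proper U V f.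

Lemma famset_open n (X : mxfam R g n) : famset X -> exists2 d : R, 0 < d &
  forall Y : mxfam R g n, cube d (fun j => Y j - X j) -> famset Y.
Proof.
by move=> UX; exact: open_cube (@openU n) UX.
Qed.

Lemma famset_dsum n m (X : mxfam R g n) (Y : mxfam R g m) :
  famset X -> famset Y -> famset (upper_block X (fun=> 0) Y).
Proof.
move=> UX UY; have := closedU.2 _ _ _ _ UX UY; rewrite /famset.
by congr (U _ (tmk _)); apply/funext => j; rewrite !tcomp_tmk.
Qed.

Lemma fammap_free : free_on (@famset) (@fammap).
Proof.
move=> n m X Y G UX UY XY; apply: freef => // j.
by rewrite !tcomp_tmk; exact: XY.
Qed.

Lemma fammap_dsum n m (X : mxfam R g n) (Y : mxfam R g m) :
  famset X -> famset Y -> forall j,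
  fammap (upper_block X (fun=> 0) Y) j = block_mx (fammap X j) 0 0 (fammap Y j).
Proof.
move=> UX UY j; have UZ := famset_dsum UX UY.
have : fammap (upper_block X (fun=> 0) Y) j *m col_mx 0 1%:M = col_mx 0 1%:M *m fammap Y j.
  apply: fammap_free => // i; rewrite /upper_block mul_block_col mul_col_mx.
  by rewrite !mulmx0 !mulmx1 !mul0mx mul1mx !add0r.
rewrite (free_upper_block fammap_free) // mul_block_col mul_col_mx.
rewrite !mulmx0 !mulmx1 !mul0mx mul1mx !add0r => /eq_col_mx [-> _].
by [].
Qed.

(* With [K = G Y - X G], the tuple [Z t = [[X, t K], [0, Y]]] is similar to the
   direct sum of [X] and [Y], and [f (Z t)] does not depend on [t] as [G]
   intertwines [f X] and [f Y].  By properness the line of all [Z t] cannot leave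
   [U], which is bounded; so [K = 0]. *)
Lemma fammap_reflects_intertwining n m (X : mxfam R g n) (Y : mxfam R g m) G :
  famset X -> famset Y -> intertwines (fammap X) (fammap Y) G -> intertwines X Y G.
Proof.
move=> UX UY fXY.
pose K j := G *m Y j - X j *m G.
pose Z (t : R) := upper_block X (fun j => t%:C *: K j) Y.
have Z0 : Z 0 = upper_block X (fun=> 0) Y.
  by apply/funext => j; rewrite /Z /upper_block rmorph0 scale0r.
have UZ0 : famset (Z 0) by rewrite Z0; exact: famset_dsum.
have fZ t : famset (Z t) -> f (n + m)%N (tmk (Z t)) = f (n + m)%N (tmk (Z 0)).
  move=> UZ; apply: tcomp_inj; suff: forall j, fammap (Z t) j = fammap (Z 0) j by [].
  move=> j.
  (* This unipotent matrix intertwines [Z t] with [Z 0]. It commutes with [f (Z 0)] because [G]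
     intertwines [f X] and [f Y], and it cancels because it is invertible. *)
  have k1 : block_mx 1%:M (t%:C *: G) 0 1%:M *m block_mx 1%:M (- (t%:C *: G)) 0 1%:M
      = 1%:M :> 'M[R[i]]_(n + m).
    rewrite mulmx_block !mulmx1 !mul1mx !mulmx0 !mul0mx !addr0 !add0r.
    by rewrite addNr -scalar_mx_block.
  have : fammap (Z t) j *m block_mx 1%:M (t%:C *: G) 0 1%:M =
         block_mx 1%:M (t%:C *: G) 0 1%:M *m fammap (Z 0) j.
    apply: fammap_free => // i; rewrite Z0 /Z /upper_block !mulmx_block.
    rewrite !mulmx1 !mul1mx !mulmx0 !mul0mx !addr0 !add0r /K; congr block_mx.
    by rewrite scalerBr -scalemxAr -scalemxAl addrC subrK.
  have -> : block_mx 1%:M (t%:C *: G) 0 1%:M *m fammap (Z 0) j =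
            fammap (Z 0) j *m block_mx 1%:M (t%:C *: G) 0 1%:M.
    rewrite Z0 fammap_dsum // !mulmx_block.
    rewrite !mulmx1 !mul1mx !mulmx0 !mul0mx !addr0 !add0r.
    by rewrite -scalemxAr -scalemxAl fXY.
  exact: mulmx_cancelr k1.
have near_line := @open_line R g n m X K Y.
(* A point of [V] is compact, so by properness its fibre is compact, hence closed in the whole space
   and not only in [U]. *)
pose P := [set f (n + m)%N (tmk (Z 0)) : tupN R gt (n + m)].
have cP : closed (U (n + m)%N `&` (f (n + m)%N @^-1` P) : set (tupN R g (n + m))).
  apply: compact_closed; first exact: norm_hausdorff.
  apply: properf; last exact: compact_set1.
  by move=> _ ->; exact: fUV.
have all_t t : famset (Z t).
  have cR : connected [set: R].
    by apply/connected_intervalP => x y _ _.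
  pose T := [set t : R | famset (Z t)].
  suff TT : T = [set: R] by have : T t by rewrite TT.
  apply: cR.
  - by exists 0.
  - by exists T; rewrite ?setTI //; apply: near_line; exact: openU.
  - exists T; last by rewrite setTI.
    rewrite -openC.
    (* As [f] is constant on the part of the line inside [U], leaving [U] is the same as leaving the
       closed fibre. *)
    have -> : ~` T = [set t | (~` (U (n + m)%N `&` (f (n + m)%N @^-1` P))) (tmk (Z t))].
      apply/seteqP; split=> s.
        by move=> nT [Ts _]; exact: nT.
      by move=> nQ Ts; apply: nQ; split; [exact: Ts|exact: fZ].
    by apply: near_line; rewrite openC.
have [M M0 bM] := nc_bounded_entries bdU.
have K0 j : K j = 0.
  apply/matrixP => a b; rewrite [RHS]mxE; apply/eq0_normc/eqP; rewrite eq_le normc_ge0 andbT.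
  apply: (@le_eps_natP _ _ _ M) => // k; rewrite mulr0 addr0.
  have := bM _ _ (all_t k%:R) j (lshift m a) (rshift n b).
  by rewrite tcomp_tmk /Z /upper_block block_mxEur mxE normcM normc_real ger0_norm.
by move=> j; apply/esym/eqP; rewrite -subr_eq0 -/(K j) K0.
Qed.

End NoncommutativeDomains.

(** The difference quotient at [0] in the direction [X] equals [F X] for all small nonzero steps. *)
Lemma diff_homogeneous (R : realType) g gt n (F : tupN R g n -> tupN R gt n) X :
  differentiable F 0 -> F 0 = 0 ->
  (forall t : R[i], normc t <= 1 -> F (t *: X) = t *: F X) -> 'd F 0 X = F X.
Proof.
move=> dF F0 hom; rewrite -deriveE //.
apply: cvg_lim; first exact: norm_hausdorff.
apply: cvg_near_cst.
have near1 : \forall h \near (0 : (R[i] : numFieldType))^', h != 0 /\ `|h| <= 1.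
  by near=> h; split; near: h; [exact: nbhs_dnbhs_neq|exact: dnbhs0_le].
apply: filterS near1 => h [h0 h1].
rewrite F0 subr0 /= addr0 hom; first by rewrite scalerA mulVf // scale1r.
by move: h1; rewrite [leLHS]normCE lecR.
Unshelve. all: by end_near.
Qed.

(** * Propagation of linearity along the connected set [U n] *)

Section IdentityTheorem.
Variables (R : realType) (g gt : nat) (U : ncset R g) (f : ncfun R g gt).
Arguments U : clear implicits.
Arguments f : clear implicits.
Hypothesis openU : forall n, @open (tupN R g n) (U n).
Hypothesis connectedU : forall n, @connected (tupN R g n) (U n).
Hypothesis closedU : nc_closed U.
Hypothesis freef : free_map U f.
Hypothesis continuous_f : forall n (X : tupN R g n), U n X ->
  {for X, continuous (f n : tupN R g n -> tupN R gt n)}.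
Variable M : R.
Hypothesis bdf : forall n (X : 'M[R[i]]_(n, g * n)), U n X ->
  forall j a b, normc (tcomp (f n X) j a b) <= M.

Lemma fammap_continuous n (X : mxfam R g n) : famset U X -> forall e : R, 0 < e ->
  exists2 d : R, 0 < d & forall Y : mxfam R g n, cube d (fun j => Y j - X j) ->
    cube e (fun j => fammap f Y j - fammap f X j).
Proof.
move=> UX e e0; have := continuous_f UX (cube_nbhs _ e0).
move=> /nbhs_cube [d d0 dP]; exists d; [exact: d0|move=> Y cY].
by have := dP (tmk Y); rewrite (tcompK Y) (tcompK X); apply.
Qed.

Variables (n : nat) (L : {linear 'M[R[i]]_(n, g * n) -> 'M[R[i]]_(n, gt * n)}).

Definition agree_near (X : tupN R g n) : Prop := U n X /\ exists2 d : R, 0 < d &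
  forall Y : tupN R g n, cube d (fun j => tcomp Y j - tcomp X j) -> f n Y = L Y.

(** Each entry of [f - L] on the line through [X1] in direction [H] vanishes near [0], so
    [identity_principle] applies. The radius [3] exceeds the half-diagonal of [square]. *)
Lemma agree_near_disc (X1 H : 'M[R[i]]_(n, g * n)) :
  agree_near X1 -> (forall z, normc z <= 3 -> U n (X1 + z *: H)) ->
  f n (X1 + H) = L (X1 + H).
Proof.
move=> [UX1 [d d0 dP]] UH; apply: tcomp_inj => j; apply/matrixP => a b.
pose psi (z : R[i]) := tcomp (f n (X1 + z *: H)) j a b - tcomp (L (X1 + z *: H)) j a b.
suff : psi 1 = 0 by rewrite /psi scale1r => /eqP; rewrite subr_eq0 => /eqP.
have sq3 z : square z -> normc z <= 3.
  move=> [zx zy]; rewrite -(@ler_pXn2r _ 2) ?nnegrE ?normc_ge0 // sqr_normcE.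
  have h1 : `|complex.Re z| ^+ 2 <= 2 ^+ 2 by rewrite ler_pXn2r ?nnegrE.
  have h2 : `|complex.Im z| ^+ 2 <= 2 ^+ 2 by rewrite ler_pXn2r ?nnegrE.
  by move: h1 h2; rewrite !real_normK ?num_real //; lra.
have LE z : tcomp (L (X1 + z *: H)) j a b = tcomp (L X1) j a b + z * tcomp (L H) j a b.
  by rewrite linearD linearZ tcompD tcompZ !mxE.
have lineE z : tmk (fun i => tcomp X1 i + z *: tcomp H i) = X1 + z *: H.
  by rewrite tmkD -/(scalef z (tcomp H)) tmkZ !tmk_tcomp.
have [K K0 cK] := exists_cube (tcomp H).
apply: (@identity_principle R psi
   (M + (normc (tcomp (L X1) j a b) + 3 * normc (tcomp (L H) j a b))) (d / K)).
- exact: divr_gt0.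
- move=> z sz; have Uz : famset U (fun i => tcomp X1 i + z *: tcomp H i).
    by rewrite /famset lineE; apply: UH; exact: sq3.
  have := line_taylor2 (fammap_free freef) (famset_dsum closedU)
    (famset_open openU) fammap_continuous j a b Uz.
  rewrite /fammap => -[B [c [cc [r r0 E]]]].
  exists (B - tcomp (L H) j a b), c; split; first exact: cc.
  exists r; first exact: r0.
  move=> w wr; have := E w wr; rewrite !lineE /psi !LE => ->; ring.
- move=> z sz; rewrite /psi LE.
  apply: le_trans (le_normcD _ _) _; rewrite normcN; apply: lerD.
    by apply: bdf; apply: UH; exact: sq3.
  apply: le_trans (le_normcD _ _) _; rewrite lerD2l normcM.
  by rewrite ler_wpM2r ?normc_ge0 // sq3.
- move=> z zd; rewrite /psi dP ?subrr // => i a' b'.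
  rewrite tcompD tcompZ addrAC subrr add0r mxE normcM.
  move: zd; rewrite ltr_pdivlMr // => zd; apply: le_lt_trans zd.
  by rewrite ler_wpM2l ?normc_ge0 // ltW.
Qed.

(** The points near which [f] and [L] agree form an open subset of [U n], which is relatively closed
    by [agree_near_disc]; connectedness concludes. *)
Lemma agree_near_domain X0 : agree_near X0 -> forall X, U n X -> f n X = L X.
Proof.
move=> aX0.
have aU X : agree_near X -> f n X = L X.
  by move=> [_ [d d0 dP]]; apply: dP => j a b; rewrite subrr mxE normc0.
suff T : agree_near = U n by move=> X UX; apply: aU; rewrite T.
have subD (X Y Z : mxfam R g n) d e : cube d (fun j => X j - Y j) ->
    cube e (fun j => Y j - Z j) -> cube (d + e) (fun j => X j - Z j).
  move=> h1 h2 j a b; have := h1 j a b; have := h2 j a b; rewrite !mxE.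
  have := le_normcD (X j a b - Y j a b) (Y j a b - Z j a b).
  rewrite addrA subrK => k1 k2 k3; apply: le_lt_trans k1 _; exact: ltrD.
have subC (X Y : mxfam R g n) d : cube d (fun j => X j - Y j) -> cube d (fun j => Y j - X j).
  by move=> h j a b; have := h j a b; rewrite !mxE normcB.
apply: connectedU.
- by exists X0.
- exists agree_near; last by apply/seteqP; split=> [X aX|X []] //; split=> //; case: aX.
  rewrite openE => X [UX [d d0 dP]].
  have d2 : 0 < d / 2 by rewrite divr_gt0.
  apply: filterS (filterI (open_nbhs_nbhs (conj (@openU n) UX)) (cube_nbhs X d2)).
  move=> Y [UY cY]; split; first exact: UY.
  exists (d / 2); first exact: d2.
  move=> Z cZ; apply: dP; have := subD _ _ _ _ _ cZ cY.
  by apply: cube_le; rewrite -splitr.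
- exists (closure agree_near); first exact: closed_closure.
  apply/seteqP; split=> [X aX|X [UX cX]].
    by split; [case: aX|exact: subset_closure].
  have [d d0 dU] := nbhs_cube (open_nbhs_nbhs (conj (@openU n) UX)).
  (* [X1] is within [e] of [X] and [Y] within [2 * e] of [X1], so the disc of radius [3] stays
     within [e + 3 * (2 * e) = d] of [X]. *)
  pose e := d / 7; have e0 : 0 < e by rewrite divr_gt0.
  have [X1 [aX1 cX1]] := cX _ (cube_nbhs X e0).
  split; first exact: UX.
  exists e; first exact: e0.
  move=> Y cY; rewrite -(subrKC X1 Y).
  apply: agree_near_disc; first exact: aX1.
  move=> z z3; apply: dU => j a b.
  have h1 := cX1 j a b; have h2 := subD _ _ _ _ _ cY (subC _ _ _ cX1) j a b.
  rewrite /= in h1.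
  have -> : (tcomp (X1 + z *: (Y - X1)) j - tcomp X j) a b =
     (tcomp X1 j - tcomp X j) a b + z * (tcomp Y j - tcomp X1 j) a b.
    by rewrite !mxE; ring.
  apply: le_lt_trans (le_normcD _ _) _; rewrite normcM.
  apply: (@lt_le_trans _ _ (e + 3 * (e + e))); last by rewrite /e; lra.
  apply: ltr_leD => //; apply: ler_pM; rewrite ?normc_ge0 //.
  exact: ltW h2.
Qed.

End IdentityTheorem.

Theorem theorem4p4 (R : realType) (g gt : nat) (U : ncset R g) (V : ncset R gt)
  (f : ncfun R g gt) :
  nc_domain U -> nc_bounded U -> nc_contains0 U ->
  nc_domain V -> nc_bounded V -> nc_contains0 V ->
  maps_into U V f -> free_map U f -> nc_analytic U f -> nc_proper U V f ->
  (forall n : nat, f n 0 = 0) ->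
  nc_circular U -> nc_circular (nc_range U f) ->
  forall n : nat, exists L : {linear 'M[R[i]]_(n, g * n) -> 'M[R[i]]_(n, gt * n)},
    forall X : 'M[R[i]]_(n, g * n), U n X -> f n X = L X.
Proof.
move=> [closedU domU] bdU U0 _ bdV _ fUV freef anf properf f0 circU circf n.
have openU m : @open (tupN R g m) (U m) by case: (domU m).
have connU m : @connected (tupN R g m) (U m) by case: (domU m).
have contf m (X : tupN R g m) : U m X ->
    {for X, continuous (f m : tupN R g m -> tupN R gt m)}.
  by move=> UX; apply: differentiable_continuous; exact: anf.
have [M1 M10 bU] := nc_bounded_entries bdU.
have [M2 M20 bV] := nc_bounded_entries bdV.
have bf m (X : 'M[R[i]]_(m, g * m)) : U m X ->
    forall j a b, normc (tcomp (f m X) j a b) <= M2.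
  by move=> UX; apply: bV; exact: fUV.
(* The arguments near [0] use one bound for both the points of [U] and the values of [f]. *)
pose M := Num.max M1 M2.
have M0 : 0 <= M by rewrite le_max M10.
have bU' m (X : mxfam R g m) : famset U X -> forall j a b, normc (X j a b) <= M.
  move=> UX j a b; have := bU _ _ UX j a b; rewrite (tcomp_tmk X) => h.
  by rewrite le_max h.
have bf' m (X : mxfam R g m) : famset U X -> forall j a b, normc (fammap f X j a b) <= M.
  by move=> UX j a b; rewrite le_max (bf _ _ UX j a b) orbT.
have circU' m (X : mxfam R g m) c : normc c = 1 -> famset U X -> famset U (scalef c X).
  move=> c1 UX; have [t ->] := unit_complex_trigo c1.
  by rewrite /famset tmkZ; exact: circU.
have circf' m (X : mxfam R g m) c : normc c = 1 -> famset U X ->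
    exists2 Y, famset U Y & forall j, fammap f Y j = c *: fammap f X j.
  move=> c1 UX; have [t ->] := unit_complex_trigo c1.
  have [|Y UY YE] := circf m (f m (tmk X)) t; first by exists (tmk X).
  exists (tcomp Y); first by rewrite /famset tmk_tcomp.
  by move=> j; rewrite /fammap tmk_tcomp YE tcompZ.
have open0 m : exists2 d : R, 0 < d & forall X : mxfam R g m, cube d X -> famset U X.
  have [|d d0 dU] := famset_open openU (X := fun=> 0 : 'M[R[i]]_m).
    by rewrite /famset tmk0; exact: U0.
  exists d; first exact: d0.
  by move=> X cX; apply: dU => j a b; rewrite subr0; exact: cX.
have f0' m j : fammap f (fun=> 0 : 'M[R[i]]_m) j = 0.
  by rewrite /fammap tmk0 f0 tcomp0.
have [r r0 hom] := homogeneous_near0 M0 bU' bf' (fammap_free freef)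
  (fammap_reflects_intertwining openU closedU bdU fUV freef properf)
  circU' circf' open0 f0' n.
(* The linear map is the derivative at [0]: homogeneity near [0] makes [f] equal to it there. *)
exists ('d (f n : tupN R g n -> tupN R gt n) 0).
apply: (agree_near_domain openU connU closedU freef contf bf (X0 := 0)).
split; first exact: U0.
exists r; first exact: r0.
move=> X cX; apply/esym/diff_homogeneous; [exact: anf|exact: f0|].
move=> t t1; apply: tcomp_inj => j.
have cX' : cube r (tcomp X).
  by move=> i a b; have := cX i a b; rewrite tcomp0 subr0.
have := hom _ cX' t t1 j.
by rewrite /fammap tmkZ tmk_tcomp tcompZ.
Qed.
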